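(* For finite automata, the CSNNI control problem is in PTIME: given a finite automaton $A$ over $\Sigma=\Sigma_l\uplus\Sigma_h$ and a set $\Sigma_c\subseteq\Sigma$ of controllable actions, one can decide in polynomial time whether there exists a controller $C$ such that $C(A)$ is CSNNI.
   Context: A finite automaton is $A=(Q,q_0,\Sigma^\varepsilon,E)$ with finite states $Q$, initial $q_0$, finite alphabet $\Sigma$, $\Sigma^\varepsilon=\Sigma\cup\{\varepsilon\}$ and edges $E\subseteq Q\times\Sigma^\varepsilon\times Q$ (time is not taken into account). For $L\subseteq\Sigma$, $A/L$ relabels by $\varepsilon$ every edge labelled in $L$, and $A\backslash L$ deletes those edges. Write $s\xRightarrow{\varepsilon}s'$ for a (possibly empty) sequence of $\varepsilon$-steps and $\xRightarrow{a}=\xRightarrow{\varepsilon}\xrightarrow{a}\xRightarrow{\varepsilon}$ for $a\in\Sigma$. A system $T_1$ weakly simulates $T_2$ if there is a relation $\mathcal{R}$ between their states relating the initial states such that whenever $s\,\mathcal{R}\,p$ and $p\xRightarrow{a}p'$ in $T_2$ ($a\in\Sigma\cup\{\varepsilon\}$), there is $s'$ with $s\xRightarrow{a}s'$ in $T_1$ and $s'\,\mathcal{R}\,p'$. A system is CSNNI iff its $\backslash\Sigma_h$ version and its $/\Sigma_h$ version weakly simulate each other. Let $\Sigma_u=\Sigma\setminus\Sigma_c$. A controller maps each run $\rho$ of $A$ to a subset $C(\rho)\subseteq\Sigma_c$ (possibly empty); $C(A)$ is the transition system whose runs are defined inductively: the empty run is a run, and an extension $\rho\xrightarrow{e}q'$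 (a run of $A$) of a run $\rho$ of $C(A)$ is a run of $C(A)$ iff $e\in\Sigma_u$ or $e\in\Sigma_c\cap C(\rho)$. *)

(* Defs.v *)
From mathcomp Require Import all_boot.
From Stdlib Require Import Relation_Operators.
Set Implicit Arguments.
Unset Strict Implicit.
Unset Printing Implicit Defensive.

(** * Automata, weak simulation and CSNNI *)

(* A label is an [option Sigma]; [None] is the silent label epsilon. *)
Record automaton (Sigma Q : finType) := Automaton {
  initial : Q;
  edges : {set Q * option Sigma * Q} }.

Record lts (Sigma : Type) := Lts {
  lts_state : Type;
  lts_start : lts_state;
  lts_step : lts_state -> option Sigma -> lts_state -> Prop }.

(* T / L *)
Definition hide (Sigma : finType) (L : {set Sigma}) (T : lts Sigma) :
    lts Sigma :=
  Lts (lts_start T) (fun s e s' =>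
    match e with
    | None => lts_step s None s' \/
              exists2 a, a \in L & lts_step s (Some a) s'
    | Some a => a \notin L /\ lts_step s (Some a) s'
    end).

(* T \ L *)
Definition restrict (Sigma : finType) (L : {set Sigma}) (T : lts Sigma) :
    lts Sigma :=
  Lts (lts_start T) (fun s e s' =>
    match e with
    | None => lts_step s None s'
    | Some a => a \notin L /\ lts_step s (Some a) s'
    end).

Definition eps_steps (Sigma : Type) (T : lts Sigma) :
    lts_state T -> lts_state T -> Prop :=
  clos_refl_trans _ (fun s s' => lts_step s None s').

Definition weak_step (Sigma : Type) (T : lts Sigma)
    (s : lts_state T) (e : option Sigma) (s' : lts_state T) : Prop :=
  match e with
  | None => eps_steps s s'
  | Some a => exists s1 s2,
      [/\ eps_steps s s1, lts_step s1 (Some a) s2 & eps_steps s2 s']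
  end.

Definition weakly_simulates (Sigma : Type) (T1 T2 : lts Sigma) : Prop :=
  exists R : lts_state T1 -> lts_state T2 -> Prop,
    R (lts_start T1) (lts_start T2) /\
    forall s p e p', R s p -> weak_step p e p' ->
      exists2 s', weak_step s e s' & R s' p'.

Definition CSNNI (Sigma : finType) (Sh : {set Sigma}) (T : lts Sigma) : Prop :=
  weakly_simulates (restrict Sh T) (hide Sh T) /\
  weakly_simulates (hide Sh T) (restrict Sh T).

(** * Control *)

Section Control.
Variables (Sigma Q : finType) (A : automaton Sigma Q).

(* The run q0 -e1-> q1 ... -en-> qn is the sequence (e1, q1), ..., (en, qn). *)
Definition history := seq (option Sigma * Q).

Definition last_state (rho : history) : Q := last (initial A) (unzip2 rho).

Inductive is_run : history -> Prop :=
| run_nil : is_run [::]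
| run_rcons rho e q : is_run rho -> (last_state rho, e, q) \in edges A ->
    is_run (rcons rho (e, q)).

Variable Sc : {set Sigma}.

(* Only the values of a controller on runs of A matter. *)
Definition is_controller (C : history -> {set Sigma}) : Prop :=
  forall rho, is_run rho -> C rho \subset Sc.

(* Silent edges cannot be disabled: epsilon is not a controllable action. *)
Definition enabled (C : history -> {set Sigma}) (rho : history)
    (e : option Sigma) : bool :=
  match e with
  | None => true
  | Some a => (a \in ~: Sc) || (a \in Sc :&: C rho)
  end.

Inductive controlled_run (C : history -> {set Sigma}) : history -> Prop :=
| controlled_nil : controlled_run C [::]
| controlled_rcons rho e q :
    controlled_run C rho -> is_run (rcons rho (e, q)) -> enabled C rho e ->
    controlled_run C (rcons rho (e, q)).

(* C(A): controllers have full memory, so its states are histories. *)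
Definition controlled (C : history -> {set Sigma}) : lts Sigma :=
  @Lts Sigma history [::] (fun rho e rho' =>
    [/\ controlled_run C rho, controlled_run C rho' &
        exists q, rho' = rcons rho (e, q)]).

Definition CSNNI_controllable (Sh : {set Sigma}) : Prop :=
  exists2 C, is_controller C & CSNNI Sh (controlled C).

End Control.

(** * Polynomial time on deterministic multi-tape Turing machines *)

Inductive direction := MoveLeft | MoveRight | Stay.

(* Tape symbols are [option (I + G)]: [None] is the blank, I the input alphabet
   and G the auxiliary alphabet. A state with verdict [Some b] is halting, and
   accepting iff b is true. There are [tm_work.+1] tapes; tape 0 initially holds
   the input. *)
Record tm (I : finType) := TM {
  tm_work : nat;
  tm_aux : finType;
  tm_state : finType;
  tm_start : tm_state;
  tm_verdict : tm_state -> option bool;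
  tm_delta : tm_state -> {ffun 'I_tm_work.+1 -> option (I + tm_aux)} ->
    tm_state * ('I_tm_work.+1 -> option (I + tm_aux) * direction) }.

Section Machine.
Variables (I : finType) (M : tm I).

Definition symbol := option (I + tm_aux M).

(* A two-way infinite tape: [(l, r)] has the head on the first symbol of r, and
   l lists the symbols on its left, nearest first. Cells beyond either list are
   blank. *)
Definition tape := (seq symbol * seq symbol)%type.

Definition read (t : tape) : symbol := head None t.2.

Definition write_move (wd : symbol * direction) (t : tape) : tape :=
  let: (l, r) := t in
  match wd.2 with
  | MoveLeft => (behead l, head None l :: wd.1 :: behead r)
  | MoveRight => (wd.1 :: l, behead r)
  | Stay => (l, wd.1 :: behead r)
  end.

Definition config := (tm_state M * ('I_(tm_work M).+1 -> tape))%type.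

Definition start_config (w : seq I) : config :=
  (tm_start M,
   fun i => ([::], if i == ord0 then [seq Some (inl x) | x <- w] else [::])).

Definition tm_step (c : config) : config :=
  if tm_verdict c.1 is Some _ then c else
  let: (s, act) := tm_delta c.1 [ffun i => read (c.2 i)] in
  (s, fun i => write_move (act i) (c.2 i)).

Definition run_verdict (t : nat) (w : seq I) : option bool :=
  tm_verdict (iter t tm_step (start_config w)).1.

End Machine.

Definition in_PTIME (I : finType) (L : seq I -> Prop) : Prop :=
  exists (M : tm I) (c d : nat), forall w : seq I,
    exists2 b : bool,
      run_verdict M (c * size w ^ d + c) w = Some b & (b <-> L w).

(** * The CSNNI control problem *)

(* States and actions are numbered; the low actions are those not in
   [inst_high]. *)
Record instance := Instance {
  inst_states : nat;
  inst_actions : nat;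
  inst_automaton : automaton 'I_inst_actions 'I_inst_states;
  inst_high : {set 'I_inst_actions};
  inst_ctrl : {set 'I_inst_actions} }.

(* 1^|Q| 0 1^|Sigma| 0, then the characteristic vectors of q0, Sigma_h, Sigma_c
   and E (the last in lexicographic order, epsilon before the actions). The
   length is polynomial in |Q| + |Sigma|, so this is polynomially equivalent to
   listing Q, Sigma and E explicitly. *)
Definition encode (X : instance) : seq bool :=
  nseq (inst_states X) true ++ false ::
  nseq (inst_actions X) true ++ false ::
  [seq q == initial (inst_automaton X) | q <- enum 'I_(inst_states X)] ++
  [seq a \in inst_high X | a <- enum 'I_(inst_actions X)] ++
  [seq a \in inst_ctrl X | a <- enum 'I_(inst_actions X)] ++
  [seq x \in edges (inst_automaton X) |
     x <- enum {: 'I_(inst_states X) * option 'I_(inst_actions X) *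
                  'I_(inst_states X)}].

Definition CSNNI_control_problem (w : seq bool) : Prop :=
  exists2 X : instance, w = encode X &
    CSNNI_controllable (inst_automaton X) (inst_ctrl X) (inst_high X).

(* Main.v *)
From mathcomp Require Import all_boot ssralg ssrint zify.
From Stdlib Require Import FunctionalExtensionality Relation_Operators.
Require Import Defs.
Set Implicit Arguments.
Unset Strict Implicit.
Unset Printing Implicit Defensive.

(** The controller that inhibits every controllable action is optimal, so A is
    controllable iff the automaton A' obtained by deleting the controllable
    edges is CSNNI, i.e. iff A' \ Sigma_h weakly simulates A' / Sigma_h. This
    is decided by saturating the weak transition relation of A' \ Sigma_h and
    then refining the full relation on Q x Q to the greatest simulation.

    The Turing machine is obtained from a small loop language over bit arrays of
    N = |w| cells, in which every loop runs at most N times: the running time of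
    a program is then bounded by a polynomial in N by structural recursion, and
    programs denote total functions. *)

(** * Reduction to the empty controller *)

(** One of the two simulations in CSNNI is free, because hiding keeps every move of the restricted
    system; the whole question is whether the restricted system can answer the hidden one. Histories
    form an infinite state space, but both directions of the reduction go through the last state of
    a run, which makes the problem finite. The machine has no binary arithmetic: a number is the
    position of a head, hence at most N, and a repetition is a sweep of a head back to its position.
    Loops are thereby bounded by N, but a tape that is being swept cannot be used inside its loop,
    which explains the well-formedness conditions on programs. N is large enough for a valid input:
    with n states and m actions the edge block alone has n * (m + 1) * n cells, room for the weak
    transitions and for the pairs of states. A fixpoint iteration changes each of its N cells at
    most once, so N rounds suffice. On invalid words the phases still terminate, with a meaningless
    result, so the check that the input is an encoding can come last. *)

Lemma clos_refl_trans_lift (S T : Type) (r : S -> S -> Prop)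
    (q : T -> T -> Prop) (B : S -> T -> Prop) x s s' :
  (forall x s s', B x s -> q s s' -> exists2 x', r x x' & B x' s') ->
  B x s -> clos_refl_trans _ q s s' ->
  exists2 x', clos_refl_trans _ r x x' & B x' s'.
Proof.
move=> H Bx qs; elim: qs x Bx => {s s'} [s s' /H{}H|s|s t u _ IH1 _ IH2] x Bx.
- by have [x' ? ?] := H _ Bx; exists x' => //; apply: rt_step.
- by exists x => //; apply: rt_refl.
- have [y xy /IH2[z yz Bz]] := IH1 _ Bx.
  by exists z => //; apply: rt_trans xy yz.
Qed.

Section Simulation.
Variables (Sigma : Type) (T1 T2 : lts Sigma).

(** Only silent steps and steps labelled [e] have to lift, not all labels: a step of a controlled
    system projects to [uncontrolled] only when its label is uncontrollable. *)
Lemma weak_step_lift (B : lts_state T1 -> lts_state T2 -> Prop) x s e s' :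
  (forall x s s', B x s -> lts_step s e s' ->
     exists2 x', lts_step x e x' & B x' s') ->
  (forall x s s', B x s -> lts_step s None s' ->
     exists2 x', lts_step x None x' & B x' s') ->
  B x s -> weak_step s e s' -> exists2 x', weak_step x e x' & B x' s'.
Proof.
move=> He H0 Bx; have lift := clos_refl_trans_lift H0.
case: e He => [a|] He /=; last exact: lift.
move=> [s1 [s2 [ss1 s12 s2s]]].
have [x1 xx1 B1] := lift _ _ _ Bx ss1.
have [x2 x12 B2] := He _ _ _ B1 s12.
have [x3 x23 B3] := lift _ _ _ B2 s2s.
by exists x3 => //; exists x1, x2.
Qed.

(** Answers to the single steps of a weak move concatenate. Hence the refinement only has to
    challenge with single edges, while the answers stay weak. *)
Lemma weak_step_simulation (R : lts_state T1 -> lts_state T2 -> Prop) :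
  (forall s p e p', R s p -> lts_step p e p' ->
     exists2 s', weak_step s e s' & R s' p') ->
  forall s p e p', R s p -> weak_step p e p' ->
     exists2 s', weak_step s e s' & R s' p'.
Proof.
move=> H.
have lift s p p' : R s p -> eps_steps p p' ->
    exists2 s', eps_steps s s' & R s' p'.
  move=> Rsp pp; elim: pp s Rsp => {p p'} [p p' st|p|p q u _ IH1 _ IH2] s Rsp.
  - exact: (H s p None).
  - by exists s => //; apply: rt_refl.
  - have [y xy /IH2[z yz Bz]] := IH1 _ Rsp.
    by exists z => //; apply: rt_trans xy yz.
move=> s p [a|] p' Rsp /=; last exact: lift.
move=> [p1 [p2 [pp1 p12 p2p]]].
have [s1 ss1 R1] := lift _ _ _ Rsp pp1.
have [s2 /= [t1 [t2 [st1 t12 ts2]]] R2] := H _ _ _ _ R1 p12.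
have [s3 ss3 R3] := lift _ _ _ R2 p2p.
exists s3 => //; exists t1, t2; split=> //.
- exact: rt_trans ss1 st1.
- exact: rt_trans ts2 ss3.
Qed.

End Simulation.

Lemma weak_step_single (Sigma : Type) (T : lts Sigma) (s : lts_state T) e s' :
  lts_step s e s' -> weak_step s e s'.
Proof.
by case: e => [a|] st /=; [exists s, s'; split=> //; exact: rt_refl|exact: rt_step].
Qed.

Section Control.
Variables (Sigma Q : finType) (A : automaton Sigma Q) (Sc Sh : {set Sigma}).

Definition uncontrolled_label (e : option Sigma) : bool :=
  if e is Some a then a \notin Sc else true.

Definition uncontrolled : lts Sigma :=
  Lts (initial A) (fun q e q' =>
    ((q, e, q') \in edges A) && uncontrolled_label e).

Lemma controlled_run_is_run C rho : controlled_run A Sc C rho -> is_run A rho.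
Proof. by case=> // ; exact: run_nil. Qed.

Lemma last_state_rcons rho e q : last_state A (rcons rho (e, q)) = q.
Proof. by rewrite /last_state /unzip2 map_rcons last_rcons. Qed.

Lemma is_run_rcons rho e q : is_run A (rcons rho (e, q)) ->
  (last_state A rho, e, q) \in edges A.
Proof.
move E : (rcons _ _) => rho' H; case: H E => [|rho1 e1 q1 _ H].
  by case: rho.
by move=> /rcons_inj[-> -> ->].
Qed.

Definition ends_at C (rho : history Sigma Q) (q : Q) :=
  controlled_run A Sc C rho /\ last_state A rho = q.

(** No controller can block an uncontrollable edge, so this holds for every [C]. *)
Lemma uncontrolled_step_lift C rho q e q' : ends_at C rho q ->
  @lts_step _ uncontrolled q e q' ->
  exists2 rho', @lts_step _ (controlled A Sc C) rho e rho' & ends_at C rho' q'.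
Proof.
move=> [Cr <-] /andP[qE ue].
have Cr' : controlled_run A Sc C (rcons rho (e, q')).
  apply: controlled_rcons => //.
    by apply: run_rcons => //; apply: controlled_run_is_run Cr.
  by case: e ue {qE} => //= a ua; rewrite in_setC ua.
exists (rcons rho (e, q')); last by split=> //; rewrite last_state_rcons.
by split=> //; exists q'.
Qed.

Lemma controlled_step_proj C rho q e rho' : ends_at C rho q ->
  uncontrolled_label e -> @lts_step _ (controlled A Sc C) rho e rho' ->
  exists2 q', @lts_step _ uncontrolled q e q' & ends_at C rho' q'.
Proof.
move=> [Cr <-] ue [_ Cr' [q' E]]; exists q'; last first.
  by split=> //; rewrite E last_state_rcons.
rewrite /= ue andbT; apply: is_run_rcons; rewrite -E.
exact: controlled_run_is_run Cr'.
Qed.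

Lemma empty_controller_label rho e rho' :
  @lts_step _ (controlled A Sc (fun=> set0)) rho e rho' -> uncontrolled_label e.
Proof.
move=> [_ Cr' [q' E]]; case: Cr' E => [|rho1 e1 q1 _ _ en].
  by case: rho.
move=> /rcons_inj[_ <- _]; case: e1 en => //= a.
by rewrite in_setC in_setI in_set0 andbF orbF.
Qed.

Lemma hide_step_lift C rho q e q' : ends_at C rho q ->
  @lts_step _ (hide Sh uncontrolled) q e q' ->
  exists2 rho', @lts_step _ (hide Sh (controlled A Sc C)) rho e rho' &
    ends_at C rho' q'.
Proof.
move=> B; case: e => [a [aSh]|[|[a aSh]]] /(uncontrolled_step_lift B)[rho' st B'];
  exists rho' => //=; by [left|right; exists a].
Qed.

Lemma restrict_step_lift C rho q e q' : ends_at C rho q ->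
  @lts_step _ (restrict Sh uncontrolled) q e q' ->
  exists2 rho', @lts_step _ (restrict Sh (controlled A Sc C)) rho e rho' &
    ends_at C rho' q'.
Proof.
by move=> B; case: e => [a [aSh]|] /(uncontrolled_step_lift B)[rho' st B'];
  exists rho'.
Qed.

Lemma restrict_step_proj C rho q e rho' : ends_at C rho q ->
  uncontrolled_label e ->
  @lts_step _ (restrict Sh (controlled A Sc C)) rho e rho' ->
  exists2 q', @lts_step _ (restrict Sh uncontrolled) q e q' & ends_at C rho' q'.
Proof.
by move=> B ue; case: e ue => [a|] ue => [[aSh]|] /(controlled_step_proj B ue)[q' st B'];
  exists q'.
Qed.

(** Restricted to the empty controller: in general a silent step of the hidden system may be a
    controllable high action enabled by [C], which has no counterpart in [uncontrolled]. *)
Lemma hide_step_proj rho q e rho' : ends_at (fun=> set0) rho q ->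
  @lts_step _ (hide Sh (controlled A Sc (fun=> set0))) rho e rho' ->
  exists2 q', @lts_step _ (hide Sh uncontrolled) q e q' &
    ends_at (fun=> set0) rho' q'.
Proof.
move=> B; case: e => [a [aSh]|[|[a aSh]]] st;
  have [q' st' B'] := controlled_step_proj B (empty_controller_label st) st;
  exists q' => //=; by [left|right; exists a].
Qed.

Lemma hide_simulates_restrict (T : lts Sigma) :
  weakly_simulates (hide Sh T) (restrict Sh T).
Proof.
exists eq; split=> //; apply: weak_step_simulation => s p e p' <- st.
exists p' => //; apply: weak_step_single.
by case: e st => //= st; left.
Qed.

(* Inhibiting every controllable action is optimal: the simulated side has
   fewer moves to be matched, while a matching weak move only uses silent steps
   and the matched action, all of them uncontrollable. *)
Theorem controllable_uncontrolled :
  CSNNI_controllable A Sc Sh <->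
  weakly_simulates (restrict Sh uncontrolled) (hide Sh uncontrolled).
Proof.
split.
  move=> [C _ [[R [R0 HR]] _]].
  have nil_ends : ends_at C [::] (initial A) by split=> //; exact: controlled_nil.
  (* A state is reached by many histories, which [R] may treat differently; one related pair of
     histories is enough. *)
  exists (fun s p => exists rs rp,
    [/\ R rs rp, ends_at C rs s & ends_at C rp p]); split.
    by exists [::], [::].
  apply: weak_step_simulation => s p e p' [rs [rp [Rr Bs Bp]]] st.
  have [rp' stp Bp'] := hide_step_lift Bp st.
  have [rs' sts Rr'] := HR _ _ _ _ Rr (weak_step_single stp).
  have ue : uncontrolled_label e.
    by case: e st {stp sts} => //= a [_ /andP[]].
  have [s' sts' Bs'] := @weak_step_lift _ (restrict Sh uncontrolled)
    (restrict Sh (controlled A Sc C))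
    (fun q rho => ends_at C rho q) s rs e rs'
    (fun q rho rho' B => restrict_step_proj B ue)
    (fun q rho rho' B => @restrict_step_proj C rho q None rho' B isT)
    Bs sts.
  by exists s' => //; exists rs', rp'.
move=> [R [R0 HR]]; pose C (_ : history Sigma Q) : {set Sigma} := set0.
have nil_ends : ends_at C [::] (initial A) by split=> //; exact: controlled_nil.
exists C; first by move=> rho _; rewrite sub0set.
split; last exact: hide_simulates_restrict.
exists (fun rs rp => exists s p, [/\ R s p, ends_at C rs s & ends_at C rp p]).
split; first by exists (initial A), (initial A).
apply: weak_step_simulation => rs rp e rp' [s [p [Rsp Bs Bp]]] st.
have [p' stp Bp'] := hide_step_proj Bp st.
have [s' sts Rsp'] := HR _ _ _ _ Rsp (weak_step_single stp).
have [rs' sts' Bs'] := @weak_step_lift _ (restrict Sh (controlled A Sc C))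
    (restrict Sh uncontrolled)
    (fun rho q => ends_at C rho q) rs s e s'
    (fun rho q q' B => restrict_step_lift B)
    (fun rho q q' B => restrict_step_lift B) Bs sts.
by exists rs' => //; exists s', p'.
Qed.

End Control.

(** * Fragments of Turing machines *)

Section Fragments.
Variable K : nat.
Local Notation V := 'I_K.+1.

(* [inl b] is a bit, and [inr x] the marked copy of the symbol x; a mark records
   the position of a head. *)
Definition sym := option (bool + option bool).

(** A machine part with a single exit, the next state [None], so that parts compose by redirecting
    that exit. The exiting step still writes and moves. *)
Record frag := Frag {
  frag_state : finType;
  frag_start : frag_state;
  frag_delta : frag_state -> {ffun V -> sym} ->
    option frag_state * (V -> sym * direction) }.

(* Indexing a tape by int identifies the representations of a zipper that differ
   only by trailing blanks. *)
Definition atape := ((int -> sym) * int)%type.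
Definition aread (t : atape) : sym := t.1 t.2.
Definition amove (d : direction) (z : int) : int :=
  match d with
  | MoveLeft => (z - 1)%R
  | MoveRight => (z + 1)%R
  | Stay => z
  end.
Definition awrite (wd : sym * direction) (t : atape) : atape :=
  (fun z => if z == t.2 then wd.1 else t.1 z, amove wd.2 t.2).

Definition atapes := V -> atape.
Definition areads (s : atapes) : {ffun V -> sym} := [ffun i => aread (s i)].

Inductive areach (P : frag) : nat -> option (frag_state P) -> atapes ->
    atapes -> Prop :=
| areach_exit s : areach 0 None s s
| areach_step q s o a n s' :
    frag_delta q (areads s) = (o, a) ->
    areach n o (fun i => awrite (a i) (s i)) s' ->
    areach n.+1 (Some q) s s'.

Definition runs (P : frag) (T : nat) (s : atapes) (Post : atapes -> Prop) :=
  exists n s', [/\ n <= T, areach n (Some (frag_start P)) s s' & Post s'].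

Lemma runs_weaken P T T' s (Q Q' : atapes -> Prop) :
  runs P T s Q -> T <= T' -> (forall s', Q s' -> Q' s') -> runs P T' s Q'.
Proof.
move=> [n [s' [nT r q]]] TT' QQ'; exists n, s'; split=> //; last exact: QQ'.
exact: leq_trans TT'.
Qed.

Definition fact (g : {ffun V -> sym} -> V -> sym * direction) : frag :=
  @Frag unit tt (fun _ r => (None, g r)).

Definition fseq (P Q : frag) : frag :=
  @Frag (frag_state P + frag_state Q)%type (inl (frag_start P))
    (fun q r => match q with
     | inl q1 => let: (o, a) := frag_delta q1 r in
        (Some (if o is Some q' then inl q' else inr (frag_start Q)), a)
     | inr q2 => let: (o, a) := frag_delta q2 r in (omap inr o, a)
     end).

Definition fif (b : {ffun V -> sym} -> bool) (P Q : frag) : frag :=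
  @Frag (option (frag_state P + frag_state Q)%type) None
    (fun q r => match q with
     | None => (Some (Some (if b r then inl (frag_start P)
                            else inr (frag_start Q))),
                fun i => (r i, Stay))
     | Some (inl q1) => let: (o, a) := frag_delta q1 r in
         (omap (Some \o inl) o, a)
     | Some (inr q2) => let: (o, a) := frag_delta q2 r in
         (omap (Some \o inr) o, a)
     end).

(** The outer [None] is the state that tests [b]. When the body exits, its [None] is wrapped into
    [Some None], which is the test again. *)
Definition fwhile (b : {ffun V -> sym} -> bool) (P : frag) : frag :=
  @Frag (option (frag_state P)) None
    (fun q r => match q with
     | None => (if b r then Some (Some (frag_start P)) else None,
                fun i => (r i, Stay))
     | Some q1 => let: (o, a) := frag_delta q1 r in (Some o, a)
     end).

Lemma awrite_stay t : awrite (aread t, Stay) t = t.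
Proof.
case: t => f z; rewrite /awrite /aread /=; congr pair.
by apply: functional_extensionality => y; case: eqP => // ->.
Qed.

Lemma awrite_stays (s : atapes) :
  (fun i => awrite (areads s i, Stay) (s i)) = s.
Proof.
by apply: functional_extensionality => i; rewrite ffunE awrite_stay.
Qed.

Lemma runs_fact g s : runs (fact g) 1 s
  (fun s' => s' = fun i => awrite (g (areads s) i) (s i)).
Proof.
exists 1, (fun i => awrite (g (areads s) i) (s i)); split=> //.
by apply: (areach_step (o := None)); [reflexivity|exact: areach_exit].
Qed.

Lemma runs_fseq P Q T1 T2 s R S :
  runs P T1 s R -> (forall s1, R s1 -> runs Q T2 s1 S) ->
  runs (fseq P Q) (T1 + T2) s S.
Proof.
move=> [n [s1 [nT r /[swap] /[apply]]]] [m [s2 [mT r2 q]]].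
exists (n + m), s2; split=> //; first exact: leq_add.
have {r2 mT q} : @areach (fseq P Q) m (Some (inr (frag_start Q))) s1 s2.
  have : forall o, areach m o s1 s2 ->
      @areach (fseq P Q) m (omap inr o) s1 s2.
    move=> o; elim=> {m o s1 s2 r r2 mT q} [s'|q' s' o a m s2 E _ IH] /=.
      exact: areach_exit.
    by apply: areach_step IH => /=; rewrite E.
  by move=> /(_ _ r2).
suff: forall o, areach n o s s1 ->
  @areach (fseq P Q) m (Some (inr (frag_start Q))) s1 s2 ->
  @areach (fseq P Q) (n + m)
    (Some (if o is Some q' then inl q' else inr (frag_start Q))) s s2.
  by move=> /(_ _ r).
move=> o; elim=> {n o s s1 r nT} [s'|q' s' o a n s1 E _ IH] //= R2.
by apply: areach_step (IH R2) => //=; rewrite E.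
Qed.

Lemma runs_fif b P Q T s S :
  (if b (areads s) then runs P T s S else runs Q T s S) ->
  runs (fif b P Q) T.+1 s S.
Proof.
case E : (b _) => -[n [s' [nT r q]]]; exists n.+1, s'; split=> //.
- have : forall o, areach n o s s' ->
    @areach (fif b P Q) n (omap (Some \o inl) o) s s'.
    move=> o; elim=> {n o s s' r nT q E} [s|q s o a n s' E _ IH] /=.
      exact: areach_exit.
    by apply: areach_step IH; rewrite /= E.
  move=> /(_ _ r) /= H; apply: areach_step; first by rewrite /= E; reflexivity.
  by rewrite awrite_stays.
- have : forall o, areach n o s s' ->
    @areach (fif b P Q) n (omap (Some \o inr) o) s s'.
    move=> o; elim=> {n o s s' r nT q E} [s|q s o a n s' E _ IH] /=.
      exact: areach_exit.
    by apply: areach_step IH; rewrite /= E.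
  move=> /(_ _ r) /= H; apply: areach_step; first by rewrite /= E; reflexivity.
  by rewrite awrite_stays.
Qed.

Lemma runs_fwhile_stop b P s : ~~ b (areads s) ->
  runs (fwhile b P) 1 s (eq^~ s).
Proof.
move=> /negPf E; exists 1, s; split=> //; apply: areach_step.
  by rewrite /= E; reflexivity.
rewrite awrite_stays; exact: areach_exit.
Qed.

Lemma runs_fwhile_step (b : {ffun V -> sym} -> bool) P T1 T2 s R S : b (areads s) ->
  runs P T1 s R -> (forall s1, R s1 -> runs (fwhile b P) T2 s1 S) ->
  runs (fwhile b P) (T1 + T2).+1 s S.
Proof.
move=> E [n [s1 [nT r /[swap] /[apply]]]] [m [s2 [mT r2 q]]].
exists (n + m).+1, s2; split=> //; first by rewrite ltnS leq_add.
have : forall o, areach n o s s1 -> @areach (fwhile b P) m (Some None) s1 s2 ->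
    @areach (fwhile b P) (n + m) (Some o) s s2.
  move=> o; elim=> {n o s s1 r r2 nT E} [s'|q' s' o a n s1 E _ IH] //= R2.
  by apply: areach_step (IH R2) => //=; rewrite E.
move=> /(_ _ r r2) H; apply: areach_step; first by rewrite /= E; reflexivity.
by rewrite awrite_stays.
Qed.

Lemma runs_fwhile (b : {ffun V -> sym} -> bool) P T v (J : nat -> atapes -> Prop) s :
  (forall k s, k < v -> J k s -> b (areads s) /\ runs P T s (J k.+1)) ->
  (forall s, J v s -> ~~ b (areads s)) ->
  J 0 s -> runs (fwhile b P) (v * T.+1).+1 s (J v).
Proof.
move=> Hs Hv.
suff H : forall d k s, d + k = v -> J k s ->
   runs (fwhile b P) (d * T.+1).+1 s (J v) by apply: H; rewrite addn0.
elim=> [|d IH] k {}s dk Jk.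
  rewrite -dk in Hv Jk *.
  by apply: runs_weaken (runs_fwhile_stop P (Hv _ Jk)) _ _ => // s' ->.
have [|bs rP] := Hs k s _ Jk; first by lia.
have H := runs_fwhile_step bs rP (fun s1 J1 => IH k.+1 s1 _ J1).
by apply: runs_weaken (H _) _ _ => //; lia.
Qed.

Definition upd (s : atapes) (i : V) (t : atape) : atapes :=
  fun j => if j == i then t else s j.

Lemma upd_same s i t : upd s i t i = t.
Proof. by rewrite /upd eqxx. Qed.

Lemma upd_other s i t j : j != i -> upd s i t j = s j.
Proof. by rewrite /upd => /negPf ->. Qed.

Lemma upd_upd s i t t' : upd (upd s i t) i t' = upd s i t'.
Proof. by apply: functional_extensionality => j; rewrite /upd; case: eqP. Qed.

Lemma upd_id s i t : s i = t -> upd s i t = s.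
Proof.
by move=> <-; apply: functional_extensionality => j; rewrite /upd; case: eqP => // ->.
Qed.

Lemma updC s i j t u : i != j -> upd (upd s i t) j u = upd (upd s j u) i t.
Proof.
move=> ij; apply: functional_extensionality => k; rewrite /upd.
by case: (eqVneq k j) => // ->; rewrite eq_sym (negPf ij).
Qed.

Definition flocal (i : V) (g : sym -> sym * direction) : frag :=
  fact (fun r j => if j == i then g (r j) else (r j, Stay)).

Lemma runs_flocal i g s :
  runs (flocal i g) 1 s
    (fun s' => s' = upd s i (awrite (g (aread (s i))) (s i))).
Proof.
apply: runs_weaken (runs_fact _ _) _ _ => // s' ->.
apply: functional_extensionality => j; rewrite /upd ffunE.
by case: eqP => [->//|_]; rewrite awrite_stay.
Qed.

Definition fnop : frag := fact (fun r j => (r j, Stay)).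

Lemma runs_fnop s : runs fnop 1 s (eq^~ s).
Proof.
by apply: runs_weaken (runs_fact _ _) _ _ => // s' ->; rewrite awrite_stays.
Qed.

Definition fleft i := flocal i (fun x => (x, MoveLeft)).

Lemma runs_fleft i s f z : s i = (f, z) ->
  runs (fleft i) 1 s (fun s' => s' = upd s i (f, (z - 1)%R)).
Proof.
move=> E; apply: runs_weaken (runs_flocal _ _ _) _ _ => // s' ->; rewrite E.
congr (upd _ _ (_, _)); apply: functional_extensionality => y /=.
by case: eqP => [->|].
Qed.

Definition fright i := flocal i (fun x => (x, MoveRight)).

Lemma runs_fright i s f z : s i = (f, z) ->
  runs (fright i) 1 s (fun s' => s' = upd s i (f, (z + 1)%R)).
Proof.
move=> E; apply: runs_weaken (runs_flocal _ _ _) _ _ => // s' ->; rewrite E.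
congr (upd _ _ (_, _)); apply: functional_extensionality => y /=.
by case: eqP => [->|].
Qed.

(* The blank left of cell 0 is the end marker; the first move to the left leaves
   the blank cell N, if the head is there. *)
Definition frewind (i : V) : frag :=
  fseq (fleft i)
    (fseq (fwhile (fun r => r i != None) (fleft i)) (fright i)).

Lemma runs_frewind i s f N p : s i = (f, Posz p) -> p <= N ->
  f (-1)%R = None -> (forall j, j < N -> f (Posz j) <> None) ->
  runs (frewind i) (N.*2 + 3) s (fun s' => s' = upd s i (f, Posz 0)).
Proof.
move=> E pN f1 fN.
have W := @runs_fwhile (fun r => r i != None) (fleft i) 1 p
  (fun k s' => s' = upd s i (f, Posz p - 1 - Posz k)%R) (upd s i (f, Posz p - 1)%R).
(* One move at each end, [p] rounds of a test and a move for the cells p-1, ..., 0, and the failing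
   test on the blank cell -1. *)
suff: runs (frewind i) (1 + ((p * 2).+1 + 1)) s
   (fun s' => s' = upd s i (f, Posz 0)).
  by move=> H; apply: runs_weaken H _ _ => //; lia.
apply: runs_fseq; first exact: runs_fleft E.
move=> s1 ->; apply: runs_fseq.
  apply: W => [k s' kp ->|s' ->|].
  - have zE : (Posz p - 1 - Posz k)%R = Posz (p - k.+1) by lia.
    split; first by rewrite ffunE upd_same /aread /= zE; apply/eqP/fN; lia.
    apply: runs_weaken; first by apply: runs_fleft; rewrite upd_same.
      by [].
    by move=> _ ->; rewrite upd_upd; congr (upd _ _ (_, _)); lia.
  - rewrite ffunE upd_same /aread /=.
    have -> : (Posz p - 1 - Posz p)%R = (-1)%R by lia.
    by rewrite f1.
  - by congr (upd _ _ (_, _)); lia.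
move=> s2 ->; apply: runs_weaken; first by apply: runs_fright; rewrite upd_same.
  by [].
by move=> s3 ->; rewrite upd_upd; congr (upd _ _ (_, _)); lia.
Qed.

Definition cells (N : nat) (a : nat -> bool) (z : int) : sym :=
  if z is Posz j then if j < N then Some (inl (a j)) else None else None.

Lemma runs_frewind_cells i s N a p : s i = (cells N a, Posz p) -> p <= N ->
  runs (frewind i) (N.*2 + 3) s (fun s' => s' = upd s i (cells N a, Posz 0)).
Proof. by move=> E pN; apply: runs_frewind E pN _ _ => //= j ->. Qed.

(** Stopping on a blank makes the position saturate at [N], so an index that is too large ends out
    of bounds instead of aliasing a cell. *)
Definition finc i :=
  flocal i (fun x => (x, if x is None then Stay else MoveRight)).

Lemma runs_finc i s N a p : s i = (cells N a, Posz p) -> p <= N ->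
  runs (finc i) 1 s
    (fun s' => s' = upd s i (cells N a, Posz (minn N p.+1))).
Proof.
move=> E pN; apply: runs_weaken (runs_flocal _ _ _) _ _ => // s' ->; rewrite E.
congr (upd _ _ _); rewrite /awrite /aread /=; congr pair.
  by apply: functional_extensionality => y; case: eqP => [->|].
case: ltnP => /= H; rewrite ?minn_refl; congr Posz; lia.
Qed.

(** A register of value [N] has its head on the blank cell [N], so the blank needs a marked copy
    too. *)
Definition mark (x : sym) : sym :=
  match x with
  | None => Some (inr None)
  | Some (inl b) => Some (inr (Some b))
  | Some (inr _) => x
  end.
Definition unmark (x : sym) : sym :=
  if x is Some (inr y) then omap inl y else x.
Definition marked (x : sym) : bool := if x is Some (inr _) then true else false.

(* Runs P as many times as there are cells to the left of the head of x, whose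
   position is thus used as a unary number. *)
Definition frep (x : V) (P : frag) : frag :=
  fseq (flocal x (fun y => (mark y, Stay)))
    (fseq (frewind x)
      (fseq (fwhile (fun r => ~~ marked (r x)) (fseq P (fright x)))
        (flocal x (fun y => (unmark y, Stay))))).

Definition rep_time (N T : nat) := N * T.+2 + N.*2 + 6.

(** The head of [x] moves between rounds, so the invariant must be insensitive to that tape and the
    body must return it unchanged. The mark at cell [v] ends the sweep exactly where the head stood,
    which restores the register. *)
Lemma runs_frep x P N T v a (J : nat -> atapes -> Prop) s :
  (forall k s t, J k s -> J k (upd s x t)) ->
  (forall k s, k < v -> J k s ->
     runs P T s (fun s' => J k.+1 s' /\ s' x = s x)) ->
  J 0 s -> s x = (cells N a, Posz v) -> v <= N ->
  runs (frep x P) (rep_time N T) s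
    (fun s' => J v s' /\ s' x = (cells N a, Posz v)).
Proof.
move=> Jx HP J0 E vN.
(* The contents of the tape during the sweep. Cell -1 stays blank, so the rewind still finds the
   left end. *)
pose f z := if z == Posz v then mark (cells N a z) else cells N a z.
suff: runs (frep x P) (1 + ((N.*2 + 3) + ((v * (T + 1).+1).+1 + 1))) s
    (fun s' => J v s' /\ s' x = (cells N a, Posz v)).
  move=> H; apply: runs_weaken H _ _ => //; rewrite /rep_time.
  have := leq_mul vN (leqnn T.+2); lia.
apply: runs_fseq; first exact: runs_flocal.
move=> s1 ->; apply: runs_fseq.
  apply: (@runs_frewind x _ f N v) => //.
  - rewrite upd_same E /awrite /=; congr pair.
    by apply: functional_extensionality => y; rewrite /f; case: eqP => // ->.
  - by move=> j jN; rewrite /f /= jN; case: eqP.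
move=> s2 ->; rewrite upd_upd; apply: (@runs_fseq _ _ _ _ _
  (fun s' => J v s' /\ s' x = (f, Posz v))).
  apply: (@runs_fwhile _ _ _ _ (fun k s' => J k s' /\ s' x = (f, Posz k))).
  - move=> k s' kv [Jk Ek]; split.
      rewrite ffunE Ek /aread /f /=.
      have -> : (Posz k == Posz v) = false by lia.
      by case: ifP.
    apply: runs_fseq; first exact: HP Jk.
    move=> s4 [J4 E4]; rewrite Ek in E4.
    apply: runs_weaken (runs_fright E4) _ _ => // s5 ->.
    split; first exact: Jx.
    by rewrite upd_same; congr pair; lia.
  - by move=> s' [_ E']; rewrite ffunE E' /aread /f /= eqxx; case: ifP.
  - by split; [exact: Jx|rewrite upd_same].
move=> s3 [J3 E3]; apply: runs_weaken (runs_flocal _ _ _) _ _ => // s4 ->.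
split; first exact: Jx.
rewrite upd_same E3 /awrite /aread /=; congr pair.
apply: functional_extensionality => y; rewrite /f eqxx.
by case: eqP => [->|] //=; case: ifP.
Qed.

End Fragments.

(** * Loop programs over bit arrays *)

Inductive term (V : Type) :=
| Zero
| One
| Var of V
| Add of term V & term V
| Mul of term V & term V.
Arguments Zero {V}.
Arguments One {V}.

(* A tape is used either as an array of N bits or as a register, whose value is
   the position of its head. Registers only change as loop variables ([Loop x y c]
   runs c for x from 0 to y - 1), so the store consists of the arrays alone. Out of
   bounds, arrays read false and writes are ignored. *)
Inductive cmd (V : Type) :=
| Skip
| Seq of cmd V & cmd V
| IfA of V & term V & cmd V & cmd V
| SetA of V & term V & bool
| Loop of V & V & cmd V.
Arguments Skip {V}.

Section Semantics.
Variables (V : eqType) (N : nat).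
Implicit Types (r : V -> nat) (A : V -> nat -> bool).

Fixpoint tval r (t : term V) : nat :=
  match t with
  | Zero => 0
  | One => 1
  | Var x => r x
  | Add a b => tval r a + tval r b
  | Mul a b => tval r a * tval r b
  end.

Definition getA A x j := (j < N) && A x j.
Definition setA A x j b : V -> nat -> bool :=
  fun y k => if [&& y == x, k == j & j < N] then b else A y k.
Definition bind r (x : V) (i : nat) : V -> nat :=
  fun y => if y == x then i else r y.

Fixpoint sem (c : cmd V) r A : V -> nat -> bool :=
  match c with
  | Skip => A
  | Seq c d => sem d r (sem c r A)
  | IfA x t c d => if getA A x (tval r t) then sem c r A else sem d r A
  | SetA x t b => setA A x (tval r t) b
  | Loop x y c => foldl (fun A i => sem c (bind r x i) A) A (iota 0 (r y))
  end.

Fixpoint tvars (t : term V) : seq V :=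
  match t with
  | Zero | One => [::]
  | Var x => [:: x]
  | Add a b | Mul a b => tvars a ++ tvars b
  end.

(** A product compiles to nested repetitions, and the inner one cannot use a tape that the outer one
    is sweeping; hence the factors share no register. *)
Fixpoint nest_ok (t : term V) : bool :=
  match t with
  | Zero | One | Var _ => true
  | Add a b => nest_ok a && nest_ok b
  | Mul a b => [&& nest_ok a, nest_ok b & ~~ has (mem (tvars a)) (tvars b)]
  end.

Definition wf_access (X G : seq V) (x : V) (t : term V) : bool :=
  [&& x \notin X, x \notin G, nest_ok t &
      all (fun y => (y \in G) && (y \notin X)) (tvars t)].

(* [X]: the tapes that bound an enclosing loop; [G]: the registers in scope. The
   head of a tape of X is moving, so it must not be used inside the loop. *)
Fixpoint wf (X G : seq V) (c : cmd V) : bool :=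
  match c with
  | Skip => true
  | Seq c d => wf X G c && wf X G d
  | IfA x t c d => [&& wf_access X G x t, wf X G c & wf X G d]
  | SetA x t _ => wf_access X G x t
  | Loop x y c => [&& x \notin X, x \notin G, y \in G, y \notin X &
                      wf (y :: X) (x :: G) c]
  end.

Fixpoint writes (c : cmd V) : seq V :=
  match c with
  | Skip => [::]
  | Seq c d | IfA _ _ c d => writes c ++ writes d
  | SetA x _ _ => [:: x]
  | Loop _ _ c => writes c
  end.

Lemma sem_unwritten c r A i : i \notin writes c -> sem c r A i = A i.
Proof.
elim: c r A => [|c IHc d IHd|x t c IHc d IHd|x t b|x y c IHc] r A //=.
- by rewrite mem_cat negb_or => /andP[ic id]; rewrite IHd // IHc.
- by rewrite mem_cat negb_or => /andP[ic id]; case: ifP => _; rewrite ?IHd ?IHc.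
- rewrite inE => /negPf ix; apply: functional_extensionality => k.
  by rewrite /setA ix.
- by move=> ic; elim: (iota _ _) A => //= k s IH A; rewrite IH IHc.
Qed.

Lemma wf_unwritten c X G i : wf X G c -> i \in X -> i \notin writes c.
Proof.
move=> + iX; elim: c X G iX => [|c IHc d IHd|x t c IHc d IHd|x t b|x y c IHc] X G iX //=.
- by case/andP=> wc wd; rewrite mem_cat negb_or (IHc X G) // (IHd X G).
- by case/and3P=> _ wc wd; rewrite mem_cat negb_or (IHc X G) // (IHd X G).
- by case/and4P=> xX _ _ _; rewrite inE; apply: contraNneq xX => <-.
- by case/and5P=> _ _ _ _; apply: IHc; rewrite inE iX orbT.
Qed.

End Semantics.

Lemma setA_setA (V : eqType) N A (x : V) j c d :
  setA N (setA N A x j c) x j d = setA N A x j d.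
Proof.
do 2!apply: functional_extensionality => ?.
by rewrite /setA; case: [&& _, _ & _].
Qed.

Lemma foldl_flag (V : eqType) N A (x : V) G (test : nat -> bool) k c :
  (forall i c, i < k -> G (setA N A x 0 c) i = setA N A x 0 (c || test i)) ->
  foldl G (setA N A x 0 c) (iota 0 k) = setA N A x 0 (c || has test (iota 0 k)).
Proof.
elim: k => [|k IH] H; first by rewrite orbF.
rewrite -[in iota 0 k.+1]addn1 iotaD foldl_cat has_cat IH => [|i d ik].
  by rewrite [LHS]H //= orbF orbA.
by rewrite H // ltnW.
Qed.

(** * Compilation of loop programs to fragments *)

Section Compile.
Variable K : nat.
Local Notation V := 'I_K.+1.

(** A term acts as an iterator that repeats [P] as often as its value says; no intermediate sum or
    product is ever stored. *)
Fixpoint tfrag (t : term V) (P : frag K) : frag K :=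
  match t with
  | Zero => fnop K
  | One => P
  | Var x => frep x P
  | Add a b => fseq (tfrag a P) (tfrag b P)
  | Mul a b => tfrag a (tfrag b P)
  end.

Definition fseek (x : V) (t : term V) : frag K :=
  fseq (frewind x) (tfrag t (finc x)).

Definition is_true_cell (x : sym) : bool :=
  if x is Some (inl b) then b else false.

Fixpoint compile (c : cmd V) : frag K :=
  match c with
  | Skip => fnop K
  | Seq c d => fseq (compile c) (compile d)
  | IfA x t c d => fseq (fseek x t)
      (fif (fun r => is_true_cell (r x)) (compile c) (compile d))
  | SetA x t b => fseq (fseek x t)
      (flocal x (fun y => (if y is None then None else Some (inl b), Stay)))
  | Loop x y c =>
      fseq (frewind x) (frep y (fseq (compile c) (finc x)))
  end.

Fixpoint term_time (N : nat) (t : term V) (T : nat) : nat :=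
  match t with
  | Zero => 1
  | One => T
  | Var x => rep_time N T
  | Add a b => term_time N a T + term_time N b T
  | Mul a b => term_time N a (term_time N b T)
  end.

Definition seek_time N t := N.*2 + 3 + term_time N t 1.

Fixpoint cmd_time (N : nat) (c : cmd V) : nat :=
  match c with
  | Skip => 1
  | Seq c d => cmd_time N c + cmd_time N d
  | IfA x t c d => seek_time N t + (cmd_time N c + cmd_time N d).+1
  | SetA x t b => seek_time N t + 1
  | Loop x y c => N.*2 + 3 + rep_time N (cmd_time N c + 1)
  end.

Section Correctness.
Variable N : nat.

Section Terms.
Variables (arr : V) (A : V -> nat -> bool) (r : V -> nat).

(** [U] collects the registers that [P] itself sweeps. They have to be known because [P] may be
    nested inside a repetition driven by another register. *)
Definition increments (P : frag K) (d : nat) (U : seq V) (T : nat) :=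
  forall s p, {in U, forall x, s x = (cells N (A x), Posz (r x))} ->
    s arr = (cells N (A arr), Posz p) -> p <= N ->
    runs P T s
      (fun s' => s' = upd s arr (cells N (A arr), Posz (minn N (p + d)))).

(** [P] and [d] vary in the induction, since the first factor of a product repeats the compiled
    second factor. Saturation is harmless because min(N, min(N, p + a) + b) = min(N, p + a + b). *)
Lemma tfrag_increments t P d U T : nest_ok t ->
  arr \notin tvars t -> arr \notin U ->
  {in tvars t, forall x, r x <= N} ->
  {in tvars t, forall x, x \notin U} ->
  increments P d U T ->
  increments (tfrag t P) (tval r t * d) (tvars t ++ U) (term_time N t T).
Proof.
elim: t P d U T => [||x|a IHa b IHb|a IHa b IHb] P d U T /=.
- move=> _ _ _ _ _ _ s p _ E pN; apply: runs_weaken (runs_fnop _) _ _ => //.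
  by move=> s' ->; rewrite addn0 (minn_idPr pN) upd_id.
- by move=> _ _ _ _ _; rewrite mul1n.
- rewrite inE => _ ax aU rN xU HP s p HU E pN.
  have rxN : r x <= N by apply: rN; rewrite inE.
  have xnU : x \notin U by apply: xU; rewrite inE.
  have xa : x != arr by rewrite eq_sym.
  pose C k := (cells N (A arr), Posz (minn N (p + k * d))).
  apply: runs_weaken; first apply: (@runs_frep _ x P N T (r x) (A x)
    (fun k s' => exists t, s' = upd (upd s arr (C k)) x t)).
  + by move=> k _ t [u ->]; exists t; rewrite upd_upd.
  + move=> k _ kv [u ->]; apply: runs_weaken.
    * apply: (HP _ (minn N (p + k * d))).
      - move=> y yU; have yx : y != x by apply: contraNneq xnU => <-.
        have ya : y != arr by apply: contraNneq aU => <-.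
        by rewrite !upd_other // HU // inE yU orbT.
      - by rewrite upd_other // upd_same.
      - by rewrite geq_minl.
    * by [].
    * move=> s' ->; split; last by rewrite upd_other.
      exists u; rewrite updC // upd_upd; congr (upd (upd _ _ (_, Posz _)) _ _).
      by rewrite mulSn; lia.
  + exists (s x); rewrite [upd _ x _]upd_id ?upd_other // upd_id // E /C.
    by rewrite mul0n addn0 (minn_idPr pN).
  + by apply: HU; rewrite inE eqxx.
  + by [].
  + by [].
  + move=> s' [[u ->]]; rewrite upd_same => ->; rewrite upd_id //.
    by rewrite upd_other // HU // inE eqxx.
- case/andP=> na nb; rewrite mem_cat negb_or => /andP[aa ab] aU rN xU HP s p HU E pN.
  apply: runs_fseq.
    apply: (IHa P d U T) E pN => //.
    + by move=> x xa; apply: rN; rewrite mem_cat xa.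
    + by move=> x xa; apply: xU; rewrite mem_cat xa.
    + move=> x; rewrite mem_cat => xaU; apply: HU.
      by rewrite !mem_cat orbAC -orbA; case/orP: xaU => -> //; rewrite !orbT.
  move=> s1 ->; apply: runs_weaken.
  + apply: (IHb P d U T _ _ _ _ _ HP _ (minn N (p + tval r a * d))) => //.
    * by move=> x xa; apply: rN; rewrite mem_cat xa orbT.
    * by move=> x xa; apply: xU; rewrite mem_cat xa orbT.
    * move=> x xbU; rewrite upd_other.
        apply: HU; move: xbU; rewrite !mem_cat => /orP[] ->; rewrite ?orbT //.
      apply: contraTneq xbU => ->; by rewrite mem_cat negb_or ab aU.
    * by rewrite upd_same.
    * by rewrite geq_minl.
  + by [].
  + move=> s' ->; rewrite upd_upd; congr (upd _ _ (_, Posz _)).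
    by rewrite mulnDl; lia.
- case/and3P=> na nb nab; rewrite mem_cat negb_or => /andP[aa ab] aU rN xU HP.
  rewrite -mulnA -catA; apply: IHa => //.
  + by rewrite mem_cat negb_or ab.
  + by move=> x xa; apply: rN; rewrite mem_cat xa.
  + move=> x xa; rewrite mem_cat negb_or xU ?mem_cat ?xa // andbT.
    by apply: contra nab => xb; apply/hasP; exists x.
  + apply: IHb => //.
    * by move=> x xb; apply: rN; rewrite mem_cat xb orbT.
    * by move=> x xb; apply: xU; rewrite mem_cat xb orbT.
Qed.

Lemma finc_increments : increments (finc arr) 1 [::] 1.
Proof. by move=> s p _ E pN; rewrite addn1; apply: runs_finc. Qed.

End Terms.

(** Nothing is claimed on [X], where heads are in the middle of a sweep and a mark is present.
    Elsewhere the head position is free unless the tape is a register in scope. *)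
Definition tapes_ok (X G : seq V) (r : V -> nat) A (s : atapes K) :=
  forall i, i \notin X -> exists p,
    [/\ p <= N, s i = (cells N (A i), Posz p) & i \in G -> p = r i].

Lemma runs_fseek X G r A s x t : wf_access X G x t -> tapes_ok X G r A s ->
  runs (fseek x t) (seek_time N t) s
    (fun s' => s' = upd s x (cells N (A x), Posz (minn N (tval r t)))).
Proof.
case/and4P=> xX xG nt /allP ht ok.
have [p [pN E _]] := ok x xX.
have xt : x \notin tvars t by apply: contra xG => /ht /andP[].
have okt y : y \in tvars t -> s y = (cells N (A y), Posz (r y)) /\ r y <= N.
  by case/ht/andP=> yG yX; have [q [qN Eq /(_ yG) <-]] := ok y yX.
apply: runs_fseq; first exact: runs_frewind_cells E pN.
move=> s1 ->; apply: runs_weaken.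
- apply: (tfrag_increments nt xt _ _ _ (finc_increments (A := A) (r := r)) (p := 0)) => //.
  + by move=> y /okt[].
  + move=> y; rewrite cats0 => yt; rewrite upd_other; first by case: (okt y).
    by apply: contraNneq xt => <-.
  + by rewrite upd_same.
- by [].
- by move=> s' ->; rewrite upd_upd muln1.
Qed.

Lemma tapes_ok_upd X G r A s x p : tapes_ok X G r A s -> x \notin G ->
  p <= N -> tapes_ok X G r A (upd s x (cells N (A x), Posz p)).
Proof.
move=> ok xG pN i iX; case: (eqVneq i x) => [->|ix].
  by exists p; rewrite upd_same (negPf xG).
by rewrite upd_other //; apply: ok.
Qed.

Lemma cells_set (A : V -> nat -> bool) x j b z :
  cells N (setA N A x j b x) z =
  if (z == Posz j) && (j < N) then Some (inl b) else cells N (A x) z.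
Proof.
case: z => [k|k] //=; rewrite /setA eqxx /= eqz_nat.
by case: (eqVneq k j) => //= ->; case: ltnP.
Qed.

(** The second conjunct is what an enclosing [frep] asks of its body: the swept tapes come back
    untouched. *)
Theorem compile_correct c X G r A s : wf X G c -> tapes_ok X G r A s ->
  runs (compile c) (cmd_time N c) s (fun s' =>
    tapes_ok X G r (sem N c r A) s' /\ {in X, s' =1 s}).
Proof.
elim: c X G r A s => [|c IHc d IHd|x t c IHc d IHd|x t b|x y c IHc] X G r A s /=.
- by move=> _ ok; apply: runs_weaken (runs_fnop _) _ _ => // s' ->.
- case/andP=> wc wd ok; apply: runs_fseq; first exact: IHc wc ok.
  move=> s1 [ok1 E1]; apply: runs_weaken; first exact: IHd wd ok1.
    by [].
  by move=> s2 [ok2 E2]; split=> // i iX; rewrite E2 // E1.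
- case/and3P=> wt wc wd ok; apply: runs_fseq; first exact: runs_fseek wt ok.
  move=> s1 E1; have /and4P[xX xG _ _] := wt.
  have {}ok1 : tapes_ok X G r A s1.
    by rewrite E1; apply: tapes_ok_upd => //; rewrite geq_minl.
  have F1 : {in X, s1 =1 s}.
    by move=> i iX; rewrite E1 upd_other //; apply: contraNneq xX => <-.
  apply: runs_fif.
  have -> : is_true_cell (areads s1 x) = getA N A x (tval r t).
    rewrite ffunE E1 upd_same /getA; case: (ltnP (tval r t) N) => h.
      by rewrite /aread /= h.
    by rewrite /aread /= ltnn.
  case: (getA _ _ _ _).
    apply: runs_weaken; [exact: IHc wc ok1|lia|].
    by move=> s2 [ok2 E2]; split=> // i iX; rewrite E2 ?F1 //.
  apply: runs_weaken; [exact: IHd wd ok1|lia|].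
  by move=> s2 [ok2 E2]; split=> // i iX; rewrite E2 ?F1 //.
- move=> wt ok; apply: runs_fseq; first exact: runs_fseek wt ok.
  move=> s1 ->; have /and4P[xX xG _ _] := wt.
  apply: runs_weaken (runs_flocal _ _ _) _ _ => // s2 ->; rewrite upd_upd.
  split; last first.
    by move=> i iX; rewrite upd_other //; apply: contraNneq xX => <-.
  move=> i iX; case: (eqVneq i x) => [->|ix]; last first.
    rewrite upd_other // /setA; have [p [pN -> ip]] := ok i iX.
    exists p; split=> //; congr pair; apply: functional_extensionality.
    by case=> //= k; rewrite (negPf ix).
  rewrite !upd_same (negPf xG); exists (minn N (tval r t)); split=> //.
    by rewrite geq_minl.
  rewrite /awrite /=; congr pair; apply: functional_extensionality => z.
  rewrite cells_set; case: (ltnP (tval r t) N) => h.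
    by rewrite /aread /= h andbT.
  rewrite /aread /= andbF ltnn.
  by case: eqP => // ->; rewrite /= ltnn.
- case/and5P=> xX xG yG yX wc ok.
  have yx : y != x by apply: contraNneq xG => <-.
  have [p [pN E _]] := ok x xX.
  have [q [qN Ey]] := ok y yX.
  move=> /(_ yG) qE; rewrite {}qE in qN Ey.
  apply: runs_fseq; first exact: runs_frewind_cells E pN.
  move=> s1 ->.
  pose B k := foldl (fun A i => sem N c (bind r x i) A) A (iota 0 k).
  (* The body does not write the array of the bounding tape, so the cells that [frep] gives back
     agree with the semantics. *)
  have By k : B k y = A y.
    rewrite /B; elim: (iota _ _) A {E Ey ok B} => //= i l IH A.
    by rewrite IH sem_unwritten // (wf_unwritten wc) // inE eqxx.
  apply: runs_weaken; first apply: (@runs_frep _ y _ N (cmd_time N c + 1) (r y) (A y)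
    (fun k s' => tapes_ok (y :: X) (x :: G) (bind r x k) (B k) s' /\ {in X, s' =1 s})).
  + move=> k s2 t [ok2 F2]; split.
      move=> i iyX; rewrite upd_other; first exact: ok2.
      by move: iyX; rewrite inE negb_or => /andP[].
    by move=> i iX; rewrite upd_other ?F2 //; apply: contraNneq yX => <-.
  + move=> k s2 kr [ok2 F2]; apply: runs_fseq; first exact: IHc wc ok2.
    move=> s3 [ok3 F3].
    have [|p3 [p3N E3]] := ok3 x; first by rewrite inE negb_or eq_sym yx.
    rewrite inE eqxx /bind eqxx => /(_ isT) p3E; rewrite {}p3E in E3 p3N.
    (* Since k < N, [finc] does not saturate and the loop variable really becomes [k.+1]. *)
    have kN : k < N by apply: leq_trans kr qN.
    apply: runs_weaken; [exact: runs_finc E3 p3N|by []|move=> s4 ->].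
    rewrite (minn_idPr kN); split; last first.
      by rewrite upd_other // F3 // inE eqxx.
    have BS : B k.+1 = sem N c (bind r x k) (B k).
      by rewrite /B -[in iota 0 k.+1]addn1 iotaD foldl_cat.
    split.
      move=> i; rewrite inE negb_or => /andP[iy iX]; rewrite BS.
      case: (eqVneq i x) => [->|ix].
        by exists k.+1; rewrite upd_same; split=> //; rewrite /bind eqxx.
      rewrite upd_other //; have [|pi [piN Ei Hi]] := ok3 i.
        by rewrite inE negb_or iy.
      by exists pi; split=> // /Hi; rewrite /bind (negPf ix).
    move=> i iX; rewrite upd_other; last by apply: contraNneq xX => <-.
    by rewrite F3 ?F2 // inE iX orbT.
  + split; last by move=> i iX; rewrite upd_other //; apply: contraNneq xX => <-.
    move=> i; rewrite inE negb_or => /andP[iy iX]; rewrite /B /=.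
    case: (eqVneq i x) => [->|ix]; first by exists 0; rewrite upd_same; split=> //; rewrite /bind eqxx.
    rewrite upd_other //; have [pi [piN Ei Hi]] := ok i iX.
    by exists pi; split=> //; rewrite inE (negPf ix) /bind (negPf ix).
  + by rewrite upd_other.
  + by [].
  + by [].
  + move=> s2 [[ok2 F2] E2]; split=> // i iX.
    case: (eqVneq i y) => [->|iy].
      by exists (r y); rewrite E2 -[foldl _ _ _]/(B (r y)) By.
    have [|pi [piN Ei Hi]] := ok2 i; first by rewrite inE negb_or iy.
    exists pi; split=> // iG; rewrite Hi ?inE ?iG ?orbT // /bind.
    by case: eqP => // ix; rewrite -ix iG in xG.
Qed.

End Correctness.

End Compile.

(** * From fragments to machines in polynomial time *)

(** The base [n.+1] is positive, so a larger exponent never lowers the bound and exponents can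
    simply be added. *)
Definition poly_bounded (f : nat -> nat) :=
  exists c d, forall n, f n <= c * n.+1 ^ d.

Lemma poly_const k : poly_bounded (fun=> k).
Proof. by exists k, 0 => n; rewrite expn0 muln1. Qed.

Lemma poly_id : poly_bounded (fun n => n).
Proof. by exists 1, 1 => n; rewrite expn1; lia. Qed.

Lemma poly_add f g : poly_bounded f -> poly_bounded g ->
  poly_bounded (fun n => f n + g n).
Proof.
move=> [c [d H]] [c' [d' H']]; exists (c + c'), (d + d') => n.
rewrite mulnDl leq_add //; apply: leq_trans (H n) _ || apply: leq_trans (H' n) _.
  by rewrite leq_mul2l leq_pexp2l ?leq_addr ?orbT.
by rewrite leq_mul2l leq_pexp2l ?leq_addl ?orbT.
Qed.

Lemma poly_mul f g : poly_bounded f -> poly_bounded g ->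
  poly_bounded (fun n => f n * g n).
Proof.
move=> [c [d H]] [c' [d' H']]; exists (c * c'), (d + d') => n.
by rewrite expnD mulnACA leq_mul.
Qed.

Lemma poly_le f g : poly_bounded g -> (forall n, f n <= g n) -> poly_bounded f.
Proof.
by move=> [c [d H]] fg; exists c, d => n; apply: leq_trans (fg n) (H n).
Qed.

Lemma poly_rep f : poly_bounded f -> poly_bounded (fun N => rep_time N (f N)).
Proof.
move=> pf; apply: (@poly_le _ (fun N => N * (f N + 2) + (2 * N + 6))).
  apply: poly_add; first apply: poly_mul poly_id (poly_add pf (poly_const 2)).
  by apply: poly_add (poly_const 6); apply: poly_mul (poly_const 2) poly_id.
by move=> N; rewrite /rep_time addn2 mul2n addnA.
Qed.

Section Time.
Variable K : nat.
Local Notation V := 'I_K.+1.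

Lemma poly_term (t : term V) f : poly_bounded f ->
  poly_bounded (fun N => term_time N t (f N)).
Proof.
elim: t f => [||x|a IHa b IHb|a IHa b IHb] f pf //=.
- exact: poly_const.
- exact: poly_rep.
- by apply: poly_add; [apply: IHa|apply: IHb].
- by apply: (IHa (fun N => term_time N b (f N))); apply: IHb.
Qed.

Lemma poly_rewind : poly_bounded (fun N => N.*2 + 3).
Proof.
apply: (@poly_le _ (fun N => 2 * N + 3)); last by move=> N; rewrite mul2n.
by apply: poly_add (poly_const 3); apply: poly_mul (poly_const 2) poly_id.
Qed.

Lemma poly_cmd (c : cmd V) : poly_bounded (fun N => cmd_time N c).
Proof.
have ps (t : term V) : poly_bounded (fun N => seek_time N t).
  apply: (poly_le (poly_add poly_rewind (@poly_term t (fun=> 1) (poly_const 1)))).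
  by [].
elim: c => [|c IHc d IHd|x t c IHc d IHd|x t b|x y c IHc] /=.
- exact: poly_const.
- exact: poly_add.
- apply: poly_add (ps t) _.
  apply: (poly_le (poly_add (poly_const 1) (poly_add IHc IHd))) => N.
  by rewrite add1n.
- by apply: poly_add (ps t) (poly_const 1).
- apply: poly_add poly_rewind _.
  by apply: (poly_rep (f := fun N => _ + 1)); apply: poly_add IHc (poly_const 1).
Qed.

End Time.

(** * Embedding of fragments into Turing machines *)

Section Machine.
Variable K : nat.
Local Notation V := 'I_K.+1.

(** A verdict depends on the state alone, so after the exit to [inr None] one more step reads the
    cell under the head of [out] and stores the answer in the state. *)
Definition machine (P : frag K) (out : V) : tm bool :=
  @TM bool K (option bool) (frag_state P + option bool)%type
    (inl (frag_start P))
    (fun q => if q is inr o then o else None)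
    (fun q r => match q with
     | inl q1 => let: (o, a) := frag_delta q1 r in
        (if o is Some q' then inl q' else inr None, a)
     | inr _ => (inr (Some (is_true_cell (r out))), fun i => (r i, Stay))
     end).

Definition represents (t : seq sym * seq sym) (a : atape) :=
  (forall j, nth None t.2 j = a.1 (a.2 + Posz j)%R) /\
  (forall j, nth None t.1 j = a.1 (a.2 - Posz j.+1)%R).

Lemma represents_write P out (wd : sym * direction)
    (t : seq sym * seq sym) a :
  represents t a ->
  represents (@write_move _ (machine P out) wd t) (awrite wd a).
Proof.
case: t a wd => l r [f z] [x d] [/= Hr Hl].
have Hr' j : nth None (behead r) j = f (z + Posz j.+1)%R.
  by rewrite nth_behead Hr.
case: d; split=> j /=.
- case: j => [|[|j]] /=.
  + rewrite -nth0 Hl; case: eqP => [|_]; first by lia.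
    by congr f; lia.
  + by case: eqP => //; lia.
  + rewrite Hr'; case: eqP => [|_]; first by lia.
    by congr f; lia.
- rewrite nth_behead Hl; case: eqP => [|_]; first by lia.
  by congr f; lia.
- rewrite Hr'; case: eqP => [|_]; first by lia.
  by congr f; lia.
- case: j => [|j] /=; first by case: eqP => //; lia.
  rewrite Hl; case: eqP => [|_]; first by lia.
  by congr f; lia.
- case: j => [|j] /=; first by case: eqP => //; lia.
  rewrite Hr'; case: eqP => [|_]; first by lia.
  by congr f; lia.
- rewrite Hl; case: eqP => [|_]; first by lia.
  by congr f; lia.
Qed.

Lemma represents_read (t : seq sym * seq sym) a :
  represents t a -> head None t.2 = aread a.
Proof.
by move=> [Hr _]; rewrite -nth0 Hr /aread; congr (_ _); lia.
Qed.

Lemma machine_reach P out n o s s' (tp : V -> seq sym * seq sym) :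
  areach n o s s' -> (forall i, represents (tp i) (s i)) ->
  exists tp', iter n (@tm_step _ (machine P out))
      (if o is Some q then inl q else inr None, tp) = (inr None, tp') /\
    forall i, represents (tp' i) (s' i).
Proof.
move=> R; elim: R tp => {n o s s'} [s|q s o a n s' E _ IH] tp H.
  by exists tp.
rewrite iterSr.
have -> : @tm_step _ (machine P out) (inl q, tp) =
    (if o is Some q then inl q else inr None,
     fun i => @write_move _ (machine P out) (a i) (tp i)).
  rewrite /tm_step /=.
  have -> : [ffun i => @read _ (machine P out) (tp i)] = areads s.
    by apply/ffunP => i; rewrite !ffunE; apply: represents_read.
  by rewrite E.
by apply: IH => i; apply: represents_write.
Qed.

Lemma iter_tm_step_halted (M : tm bool) (c : config M) b t :
  tm_verdict c.1 = Some b -> iter t (@tm_step _ M) c = c.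
Proof.
by move=> E; elim: t => //= t ->; rewrite /tm_step E.
Qed.

Lemma machine_verdict_le P out s w T T' (b : bool) :
  (forall i, represents (([::], if i == ord0 then [seq Some (inl x) | x <- w]
     else [::]) : seq sym * seq sym) (s i)) ->
  runs P T s (fun s' => is_true_cell (aread (s' out)) = b) ->
  T < T' -> run_verdict (machine P out) T' w = Some b.
Proof.
move=> H [n [s' [nT R <-]]] TT'.
have [tp' [E H']] := machine_reach out R H.
(* [n] steps of the fragment, one step into the verdict, and the remaining steps leave the halted
   configuration unchanged. *)
rewrite /run_verdict (_ : T' = (T' - n.+1) + n.+1); last by lia.
rewrite iterD iterS [iter n _ _]E.
have -> : @tm_step _ (machine P out) (inr None, tp') =
  (inr (Some (is_true_cell (aread (s' out)))),
     fun i => @write_move _ (machine P out) (@read _ (machine P out) (tp' i), Stay) (tp' i)).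
  rewrite /tm_step /= ffunE [read _](represents_read (H' out)); congr pair.
  by apply: functional_extensionality => i; rewrite ffunE.
by rewrite (iter_tm_step_halted (b := is_true_cell (aread (s' out)))).
Qed.

End Machine.

(** * Initialisation of the tapes *)

Section Decider.
Variable K : nat.
Local Notation V := 'I_K.+1.
Variables (fv : V -> bool) (ns ms : seq V) (total out : V).

Definition conf (N : nat) (A : V -> nat -> bool) (p : V -> nat) : atapes K :=
  fun i => (cells N (A i), Posz (p i)).

(** Every tape receives as many cells as the input has. All heads end at N, already the right value
    for [total], which is therefore the one tape that is not rewound afterwards. *)
Definition ffill : frag K :=
  fwhile (fun r => r ord0 != None)
    (fact (fun r i => (if i == ord0 then r i else Some (inl (fv i)), MoveRight))).

Definition input_arrays (w : seq bool) (i : V) (j : nat) : bool :=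
  if i == ord0 then nth false w j else fv i.

Definition start_tapes (w : seq bool) : atapes K :=
  fun i => (if i == ord0 then cells (size w) (nth false w) else fun=> None,
            Posz 0).

Lemma runs_ffill w : runs ffill (size w * 2).+1 (start_tapes w)
  (fun s => s = conf (size w) (input_arrays w) (fun=> size w)).
Proof.
pose st k : atapes K := fun i =>
  (if i == ord0 then cells (size w) (nth false w) else cells k (fun=> fv i),
   Posz k).
apply: runs_weaken; first apply: (@runs_fwhile _ _ _ 1 (size w)
  (fun k s => s = st k)).
- move=> k _ kw ->; split; first by rewrite ffunE /aread /= kw.
  apply: runs_weaken (runs_fact _ _) _ _ => // _ ->.
  apply: functional_extensionality => i; rewrite /st ffunE /awrite /aread /=.
  congr pair; last by lia.
  apply: functional_extensionality => z; case: (eqVneq i ord0) => _.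
    by case: eqP => // ->.
  case: z => [j|j] //=; rewrite eqz_nat ltnS [j <= k]leq_eqVlt.
  by case: (j == k).
- by move=> _ ->; rewrite ffunE /aread /= ltnn.
- apply: functional_extensionality => i; rewrite /start_tapes /st.
  case: eqP => // _; congr pair; apply: functional_extensionality.
  by case.
- by [].
- move=> _ ->; apply: functional_extensionality => i.
  rewrite /conf /st /input_arrays; congr pair.
  by apply: functional_extensionality; case=> //= j; case: eqP.
Qed.

Definition frewinds (l : seq V) : frag K :=
  foldr (fun i P => fseq (frewind i) P) (fnop K) l.

Lemma runs_frewinds l N A p : (forall i, p i <= N) ->
  runs (frewinds l) (size l * (N.*2 + 3)).+1 (conf N A p)
    (fun s => s = conf N A (fun i => if i \in l then 0 else p i)).
Proof.
elim: l p => [|i l IH] p pN /=.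
  by apply: runs_weaken (runs_fnop _) _ _ => // s ->.
rewrite mulSn -addnS; apply: runs_fseq.
  exact: (runs_frewind_cells (erefl : conf N A p i = _) (pN i)).
move=> s1 ->; apply: runs_weaken.
- rewrite (_ : upd _ _ _ = conf N A (fun j => if j == i then 0 else p j)).
    by apply: IH => j; case: eqP.
  by apply: functional_extensionality => j; rewrite /upd /conf; case: eqP => // ->.
- by [].
- move=> s2 ->; apply: functional_extensionality => j; rewrite /conf inE.
  by case: (j \in l); case: eqP.
Qed.

(** The heads in [R] move along with the input head, so the length of a unary block of the encoding
    becomes their register value. *)
Definition fscan (R : seq V) : frag K :=
  fwhile (fun r => is_true_cell (r ord0))
    (fact (fun r i => (r i, if (i == ord0) || (i \in R) then MoveRight
                            else Stay))).

Lemma runs_fscan R w p :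
  runs (fscan R) (find negb (drop (p ord0) w) * 2).+1
    (conf (size w) (input_arrays w) p)
    (fun s => s = conf (size w) (input_arrays w)
      (fun i => if (i == ord0) || (i \in R)
                then p i + find negb (drop (p ord0) w) else p i)).
Proof.
set u := find _ _.
apply: runs_weaken; first apply: (@runs_fwhile _ _ _ 1 u
  (fun k s => s = conf (size w) (input_arrays w)
      (fun i => if (i == ord0) || (i \in R) then p i + k else p i))).
- move=> k _ ku ->; split.
    rewrite ffunE /aread /= ?eqxx /=.
    have := before_find false ku => /negbFE; rewrite nth_drop => E.
    by case: ltnP => // h; rewrite nth_default in E.
  apply: runs_weaken (runs_fact _ _) _ _ => // _ ->.
  apply: functional_extensionality => i; rewrite ffunE /awrite /aread /conf /=.
  congr pair; last by case: ifP => _ //=; lia.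
  by apply: functional_extensionality => z; case: eqP => // ->.
- move=> _ ->; rewrite ffunE /aread /= ?eqxx /=; case: ltnP => //= h.
  have hh : has negb (drop (p ord0) w).
    by rewrite has_find size_drop -/u; lia.
  by rewrite /input_arrays eqxx -nth_drop; exact: (nth_find false hh).
- by apply: functional_extensionality => i; rewrite /conf addn0 if_same.
- by [].
- by [].
Qed.

Definition ones (w : seq bool) := find negb w.
Definition ones2 (w : seq bool) := find negb (drop (ones w).+1 w).

Definition registers (w : seq bool) (i : V) : nat :=
  if i \in ns then ones w else if i \in ms then ones2 w
  else if i == total then size w else 0.

Definition scope := ns ++ ms ++ [:: total].

Definition fprogram (c : cmd V) : frag K :=
  fseq ffill
    (fseq (frewinds [seq i <- enum V | i != total])
      (fseq (fscan ns)
        (fseq (finc ord0)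
          (fseq (fscan ms) (fseq (compile c) (frewind out)))))).

Definition program_time (c : cmd V) (N : nat) : nat :=
  (N * 2).+1 + ((size [seq i <- enum V | i != total] * (N.*2 + 3)).+1 +
    ((N * 2).+1 + (1 + ((N * 2).+1 + (cmd_time N c + (N.*2 + 3)))))).

Lemma runs_fprogram c w :
  ord0 \notin scope -> ~~ has (mem ns) ms ->
  total \notin ns -> total \notin ms -> out \notin scope ->
  wf [::] scope c ->
  runs (fprogram c) (program_time c (size w)) (start_tapes w)
    (fun s => is_true_cell (aread (s out)) =
       getA (size w) (sem (size w) c (registers w) (input_arrays w)) out 0).
Proof.
rewrite /scope !mem_cat !inE !negb_or => /and3P[zn zm zt] nm tn tm outs wc.
set N := size w; set A := input_arrays w.
have u1 : ones w <= N := find_size _ _.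
have u2 : ones2 w <= N - (ones w).+1.
  by rewrite /N -size_drop; exact: find_size.
apply: runs_fseq; first exact: runs_ffill.
have tnE i : i \in ns -> (i == total) = false.
  by move=> ?; apply: contraNF tn => /eqP <-.
have tmE i : i \in ms -> (i == total) = false.
  by move=> ?; apply: contraNF tm => /eqP <-.
have nmE i : i \in ms -> (i \in ns) = false.
  by move=> im; apply: contraNF nm => iN; apply/hasP; exists i.
have zE i : i \in ms -> (i == ord0) = false.
  by move=> ?; apply: contraNF zm => /eqP <-.
move=> _ ->; apply: runs_fseq; first exact: runs_frewinds.
pose p1 i := if i == total then N else 0.
move=> _ ->; rewrite (_ : conf _ _ _ = conf N A p1); last first.
  apply: functional_extensionality => i.
  by rewrite /conf /p1 mem_filter mem_enum andbT if_neg.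
have p10 : drop (p1 ord0) w = w by rewrite /p1 (negPf zt) drop0.
have scan_time (q : nat) : (find negb (drop q w) * 2).+1 <= (N * 2).+1.
  rewrite ltnS leq_mul2r /=; apply: leq_trans (find_size _ _) _.
  by rewrite size_drop leq_subr.
pose p2 i := if (i == ord0) || (i \in ns) then ones w else p1 i.
apply: runs_fseq.
  apply: (@runs_weaken _ _ _ _ _ _ (fun s => s = conf N A p2)
    (runs_fscan ns w p1) (scan_time _)).
  move=> _ ->; apply: functional_extensionality => i.
  rewrite /conf /p2 p10 -/(ones w) /p1; congr (_, Posz _).
  by case: eqP => [->|_] /=; [rewrite (negPf zt)|case: ifP => // /tnE ->].
move=> _ ->.
(* [finc] skips the separator. If [w] has none, the input head already stands on the blank cell [N]
   and stays there. *)
pose p3 i := if i == ord0 then minn N (ones w).+1 else p2 i.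
apply: runs_fseq; first by apply: (@runs_finc _ _ _ N (A ord0) (ones w)).
move=> _ ->; rewrite (_ : upd _ _ _ = conf N A p3); last first.
  apply: functional_extensionality => i; rewrite /upd /conf /p3.
  by case: eqP => // ->.
have p30 : drop (p3 ord0) w = drop (ones w).+1 w.
  rewrite /p3 eqxx; case: (leqP N (ones w).+1) => // h.
  by rewrite drop_oversize // drop_oversize.
pose p4 i := if i == ord0 then minn N (ones w).+1 + ones2 w
  else if i \in ms then ones2 w else p2 i.
apply: runs_fseq.
  apply: (@runs_weaken _ _ _ _ _ _ (fun s => s = conf N A p4)
    (runs_fscan ms w p3) (scan_time _)).
  move=> _ ->; apply: functional_extensionality => i.
  rewrite /conf /p4 p30 -/(ones2 w) /p3 /p2 /p1; congr (_, Posz _).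
  case: eqP => //= _; case: ifP => // im.
  by rewrite nmE // tmE.
move=> _ ->; apply: runs_fseq.
  apply: (compile_correct (A := A) (r := registers w) wc) => i _.
  exists (p4 i); split=> //.
  - rewrite /p4 /p2 /p1; case: (eqVneq i ord0) => [_|i0] /=; first by lia.
    by case: ifP => _; [lia|]; case: ifP => // _; case: ifP.
  - rewrite /scope !mem_cat inE => H.
    have i0 : i != ord0.
      by apply: contraTneq H => ->; rewrite !negb_or zn zm zt.
    rewrite /p4 /p2 /p1 (negPf i0) /= /registers.
    by case: ifP => // im; rewrite nmE.
move=> s1 [ok _]; have [p [pN E _]] := ok out isT.
apply: runs_weaken; [exact: runs_frewind_cells E pN|by []|move=> _ ->].
rewrite upd_same /aread /= /getA; by case: ltnP.
Qed.

Lemma start_tapes_represents w i :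
  represents (([::], if i == ord0 then [seq Some (inl x) | x <- w]
     else [::]) : seq sym * seq sym) (start_tapes w i).
Proof.
rewrite /start_tapes; split=> j /=; last by rewrite nth_nil; case: eqP.
rewrite GRing.add0r; case: eqP => /= _; last by rewrite nth_nil.
case: ltnP => h; first by rewrite (nth_map false).
by rewrite nth_default // size_map.
Qed.

Theorem decider_in_PTIME c (L : seq bool -> Prop) :
  ord0 \notin scope -> ~~ has (mem ns) ms ->
  total \notin ns -> total \notin ms -> out \notin scope ->
  wf [::] scope c ->
  (forall w, getA (size w)
     (sem (size w) c (registers w) (input_arrays w)) out 0 <-> L w) ->
  in_PTIME L.
Proof.
move=> h1 h2 h3 h4 h5 wc HL.
have [k [d H]] : poly_bounded (fun N => (program_time c N).+1).
  rewrite /program_time; set z := size _.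
  have pd : poly_bounded (fun N => (N * 2).+1).
    apply: (poly_le (poly_add (poly_mul poly_id (poly_const 2)) (poly_const 1))).
    by move=> N; rewrite addn1.
  have p1 := poly_add (poly_mul (poly_const z) poly_rewind) (poly_const 1).
  have := poly_add pd (poly_add p1 (poly_add pd (poly_add (poly_const 1)
   (poly_add pd (poly_add (poly_cmd c) (poly_add poly_rewind (poly_const 1))))))).
  by move=> h; apply: (poly_le h) => N; lia.
(* The factor 2^d removes the shift: (N + 1)^d <= 2^d N^d + 2^d, by N + 1 <= 2 N when N > 0 and by
   the additive term when N = 0. *)
exists (machine (fprogram c) out), (k * 2 ^ d), d => w.
exists (getA (size w) (sem (size w) c (registers w) (input_arrays w)) out 0);
  last exact: HL.
apply: (machine_verdict_le (start_tapes_represents w)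
  (runs_fprogram _ h1 h2 h3 h4 h5 wc)).
apply: leq_trans (H _) _; rewrite -mulnA -mulnDr leq_mul2l; apply/orP; right.
case: d {H} => [|d]; first by rewrite !expn0.
case: (posnP (size w)) => [->|w0]; first by rewrite exp1n addn_gt0 expn_gt0 orbT.
apply: (@leq_trans ((2 * size w) ^ d.+1)); first by rewrite leq_exp2r // mul2n -addnn -addn1 leq_add2l.
by rewrite expnMn leq_addr.
Qed.

End Decider.

(** * Reading the encoding *)

Lemma index_allpairs (S T : eqType) (s : seq S) (t : seq T) x y :
  x \in s -> y \in t ->
  index (x, y) [seq (a, b) | a <- s, b <- t] = index x s * size t + index y t.
Proof.
move=> + yt; elim: s => //= a s IH; rewrite inE index_cat.
case: (eqVneq x a) => [-> _|xa /= xs]; rewrite ?eqxx.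
  by rewrite map_f // index_map //; move=> u v [].
rewrite ifN; first by rewrite IH // size_map mulSn addnA.
by apply/mapP => -[b _ [xa' _]]; rewrite xa' eqxx in xa.
Qed.

Definition label_index m (l : option 'I_m) : nat := if l is Some a then a.+1 else 0.
(** The position in the lexicographic order of the encoding. The same index addresses the edges in
    the input and the weak transitions in [vS]. *)
Definition edge_index n m (q : 'I_n) (l : option 'I_m) (q' : 'I_n) : nat :=
  (q * m.+1 + label_index l) * n + q'.

Lemma index_enum_option m (l : option 'I_m) :
  index l (enum {: option 'I_m}) = label_index l.
Proof.
rewrite enumT unlock /= /option_enum; case: l => [a|] //=.
rewrite index_map; last by move=> ? ? [].
by rewrite -[Finite.enum _]enumT index_enum_ord.
Qed.

Lemma index_enum_edge n m (q : 'I_n) (l : option 'I_m) (q' : 'I_n) :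
  index (q, l, q') (enum {: 'I_n * option 'I_m * 'I_n}) = edge_index q l q'.
Proof.
rewrite enumT unlock /= /prod_enum index_allpairs ?mem_enum //.
rewrite (enumT ('I_n * option 'I_m)%type) unlock /= /prod_enum.
rewrite index_allpairs ?mem_enum // !index_enum_ord index_enum_option.
by rewrite -!cardE card_ord card_option card_ord.
Qed.

Lemma edge_index_lt n m (q : 'I_n) (l : option 'I_m) (q' : 'I_n) :
  edge_index q l q' < n * m.+1 * n.
Proof.
rewrite -index_enum_edge (_ : n * m.+1 * n = size (enum {: 'I_n * option 'I_m * 'I_n})).
  by rewrite index_mem mem_enum.
by rewrite -cardE !card_prod card_option !card_ord.
Qed.

Lemma edge_index_inj n m (q1 q2 : 'I_n) (l1 l2 : option 'I_m) (q1' q2' : 'I_n) :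
  edge_index q1 l1 q1' = edge_index q2 l2 q2' -> (q1, l1, q1') = (q2, l2, q2').
Proof.
rewrite -!index_enum_edge; set s := enum _ => E.
rewrite -(nth_index (q1, l1, q1') (_ : (q2, l2, q2') \in s)) ?mem_enum //.
by rewrite -E nth_index // mem_enum.
Qed.

Definition header_size n m := n + m + 2.
Definition encoding_size n m := header_size n m + (n + m + m + n * m.+1 * n).

Lemma size_map_enum (T : finType) (S : Type) (f : T -> S) :
  size [seq f x | x <- enum T] = #|T|.
Proof. by rewrite size_map -cardE. Qed.

Lemma nth_map_enum (T : finType) (f : T -> bool) x (s : seq bool) :
  nth false ([seq f y | y <- enum T] ++ s) (index x (enum T)) = f x.
Proof.
rewrite nth_cat size_map index_mem mem_enum (nth_map x) ?index_mem ?mem_enum //.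
by rewrite nth_index // mem_enum.
Qed.

Lemma nth_cat_shift (s t : seq bool) k j : size s = k ->
  nth false (s ++ t) (k + j) = nth false t j.
Proof. by move=> <-; rewrite nth_cat ltnNge leq_addr /= addKn. Qed.

Section Encode.
Variable X : instance.
Let n := inst_states X.
Let m := inst_actions X.
Let A := inst_automaton X.

Lemma find_negb_nseq k (s : seq bool) : find negb (nseq k true ++ false :: s) = k.
Proof. by elim: k => //= k ->. Qed.

Lemma ones_encode : ones (encode X) = n.
Proof. exact: find_negb_nseq. Qed.

Lemma ones2_encode : ones2 (encode X) = m.
Proof.
rewrite /ones2 ones_encode /encode -cat_rcons drop_size_cat.
  exact: find_negb_nseq.
by rewrite size_rcons size_nseq.
Qed.

Lemma encode_split : exists2 u, size u = header_size n m & encode X = u ++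
  [seq q == initial A | q <- enum 'I_n] ++
  [seq a \in inst_high X | a <- enum 'I_m] ++
  [seq a \in inst_ctrl X | a <- enum 'I_m] ++
  [seq x \in edges A | x <- enum {: 'I_n * option 'I_m * 'I_n}].
Proof.
exists (nseq n true ++ false :: nseq m true ++ [:: false]).
  by rewrite size_cat /= size_cat !size_nseq /header_size /=; lia.
by rewrite /encode -!catA /= -!catA.
Qed.

Lemma size_encode : size (encode X) = encoding_size n m.
Proof.
have [u su ->] := encode_split.
rewrite !size_cat !size_map_enum su !card_prod card_option !card_ord.
by rewrite /encoding_size !addnA.
Qed.

Lemma encode_initial (q : 'I_n) :
  nth false (encode X) (header_size n m + q) = (q == initial A).
Proof.
have [u su ->] := encode_split; rewrite nth_cat_shift //.
by rewrite -{1}(index_enum_ord q) nth_map_enum.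
Qed.

Lemma encode_high (a : 'I_m) :
  nth false (encode X) (header_size n m + n + a) = (a \in inst_high X).
Proof.
have [u su ->] := encode_split; rewrite -addnA nth_cat_shift //.
rewrite nth_cat_shift ?size_map_enum ?card_ord //.
by rewrite -{1}(index_enum_ord a) nth_map_enum.
Qed.

Lemma encode_ctrl (a : 'I_m) :
  nth false (encode X) (header_size n m + n + m + a) = (a \in inst_ctrl X).
Proof.
have [u su ->] := encode_split; rewrite -!(addnA (header_size n m)) nth_cat_shift // -?addnA.
rewrite nth_cat_shift ?size_map_enum ?card_ord //.
rewrite nth_cat_shift ?size_map_enum ?card_ord //.
by rewrite -{1}(index_enum_ord a) nth_map_enum.
Qed.

Lemma encode_edges (q : 'I_n) (l : option 'I_m) (q' : 'I_n) :
  nth false (encode X) (header_size n m + n + m + m + edge_index q l q') =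
  ((q, l, q') \in edges A).
Proof.
have [u su ->] := encode_split; rewrite -!(addnA (header_size n m)) nth_cat_shift // -?addnA.
rewrite nth_cat_shift ?size_map_enum ?card_ord //.
rewrite nth_cat_shift ?size_map_enum ?card_ord //.
rewrite nth_cat_shift ?size_map_enum ?card_ord //.
by rewrite -index_enum_edge -[map _ _]cats0 nth_map_enum.
Qed.

End Encode.

Lemma map_enum_slice (T : finType) (s : seq bool) k :
  k + #|T| <= size s ->
  [seq nth false s (k + index x (enum T)) | x <- enum T] =
  take #|T| (drop k s).
Proof.
move=> le; have sz : size (take #|T| (drop k s)) = #|T|.
  by rewrite size_takel // size_drop; lia.
apply: (@eq_from_nth _ false); first by rewrite size_map sz -cardE.
move=> i; rewrite size_map -cardE => iT.
have x0 : T by apply: (@enum_val T predT (Ordinal iT)).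
rewrite (nth_map x0) -?cardE // index_uniq -?cardE ?enum_uniq //.
by rewrite nth_take // nth_drop.
Qed.

Lemma map_enum_ord_slice n (s : seq bool) k : k + n <= size s ->
  [seq nth false s (k + index x (enum 'I_n)) | x <- enum 'I_n] =
  take n (drop k s).
Proof. by have := @map_enum_slice 'I_n s k; rewrite card_ord. Qed.

Lemma ones_split w : ones w < size w ->
  w = nseq (ones w) true ++ false :: drop (ones w).+1 w.
Proof.
rewrite /ones; elim: w => //= -[] w IH //= h.
  by congr cons; apply: IH.
by rewrite drop0.
Qed.

(** Only the block of the initial state is constrained, to exactly one set bit; any other block of
    the right length is the characteristic vector of some set. The set bit also supplies the state
    that an automaton must have. *)
Lemma encode_surj w (n := ones w) (m := ones2 w) :
  size w = encoding_size n m ->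
  (forall q q', q < n -> q' < n -> nth false w (header_size n m + q) ->
     nth false w (header_size n m + q') -> q = q') ->
  (exists2 q, q < n & nth false w (header_size n m + q)) ->
  exists X, w = encode X.
Proof.
move=> sz uni [q0 q0n wq0]; set h := header_size n m.
pose A := @Automaton 'I_m 'I_n (Ordinal q0n)
  [set x | nth false w (h + (n + (m + m)) + index x (enum {: 'I_n * option 'I_m * 'I_n}))].
pose H := [set a : 'I_m | nth false w (h + n + index a (enum 'I_m))].
pose C := [set a : 'I_m | nth false w (h + (n + m) + index a (enum 'I_m))].
exists (@Instance n m A H C); rewrite /encode /=.
have hE : h = n + m + 2 by [].
have szE : size w = h + (n + m + m + n * m.+1 * n) by [].
have -> : [seq q == Ordinal q0n | q <- enum 'I_n] = take n (drop h w).
  rewrite -map_enum_ord_slice; last by lia.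
  apply: eq_map => q; rewrite index_enum_ord; apply/eqP/idP => [->//|wq].
  by apply: val_inj; apply: uni => /=.
have -> : [seq a \in H | a <- enum 'I_m] = take m (drop n (drop h w)).
  rewrite drop_drop (addnC n) -map_enum_ord_slice; last by lia.
  by apply: eq_map => a; rewrite inE.
have -> : [seq a \in C | a <- enum 'I_m] = take m (drop m (drop n (drop h w))).
  rewrite !drop_drop (_ : _ + _ = h + (n + m)); last by lia.
  rewrite -map_enum_ord_slice; last by lia.
  by apply: eq_map => a; rewrite inE.
set T := (T in enum T).
have cT : #|T| = n * m.+1 * n by rewrite !card_prod card_option !card_ord.
have -> : [seq x \in edges A | x <- enum T] = drop m (drop m (drop n (drop h w))).
  rewrite !drop_drop (_ : _ + _ = h + (n + (m + m))); last by lia.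
  rewrite -[RHS](@take_oversize _ #|T|); last by rewrite size_drop cT; lia.
  rewrite -map_enum_slice; last by rewrite cT; lia.
  by apply: eq_map => a; rewrite inE.
rewrite !cat_take_drop.
have n1 : n < size w by lia.
rewrite {1}(ones_split n1) -/n; congr (_ ++ _ :: _).
have m1 : ones (drop n.+1 w) < size (drop n.+1 w).
  by rewrite -[ones (drop _ _)]/m size_drop; lia.
rewrite {1}(ones_split m1) -[ones (drop _ _)]/m drop_drop.
by congr (_ ++ _ :: drop _ _); lia.
Qed.

(** * Saturation of a bit array *)

Section Saturation.
Variables (V : eqType) (N : nat) (X : V) (b : bool).
Variables (St : (V -> nat -> bool) -> Prop) (I : (nat -> bool) -> Prop).
Implicit Types (A : V -> nat -> bool) (F : (V -> nat -> bool) -> (V -> nat -> bool)).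

(* A step F that only turns cells of the array X into b. Characterising "no
   change" by a condition on X alone is compatible with sequences and loops: by
   monotonicity, a run without effect consists of steps without effect. *)
Record saturating_at F (Cnd : (nat -> bool) -> Prop) A : Prop := Saturating {
  sat_static : St (F A);
  sat_inv : I (F A X);
  sat_mono : forall j, A X j = b -> F A X j = b;
  sat_out : forall j, N <= j -> F A X j = A X j;
  sat_fix : F A X = A X <-> Cnd (A X) }.

(** With [b] true this describes closure under rules, with [b] false the deletion of pairs. [St]
    controls the other arrays, and [I] bounds the result from the other side: nothing unsound is
    added, no needed pair is deleted. *)
Definition saturating F Cnd :=
  forall A, St A -> I (A X) -> saturating_at F Cnd A.

(** A cell turned into [b] is never turned back, so if two steps together restore [f], the array
    between them is [f] as well. *)
Lemma sat_antisym (f g h : nat -> bool) :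
  (forall j, f j = b -> g j = b) -> (forall j, g j = b -> h j = b) ->
  h = f -> g = f.
Proof.
move=> fg gh hf; apply: functional_extensionality => j.
have := fg j; have := gh j; rewrite hf.
by case: (f j) (g j) b => [] [] [] // H1 H2;
  rewrite ?H1 ?H2 // -?H1 -?H2.
Qed.

Lemma saturating_id : saturating id (fun=> True).
Proof. by move=> A sA iA; split. Qed.

Lemma saturating_seq F G C1 C2 : saturating F C1 -> saturating G C2 ->
  saturating (fun A => G (F A)) (fun f => C1 f /\ C2 f).
Proof.
move=> HF HG A sA iA; have [s1 i1 m1 o1 f1] := HF A sA iA.
have [s2 i2 m2 o2 f2] := HG _ s1 i1; split=> //.
- by move=> j /m1/m2.
- by move=> j h; rewrite o2 // o1.
- split=> [E|[/f1 E1 c2]].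
    have E1 := sat_antisym m1 m2 E.
    by split; [exact/f1|rewrite -E1; apply/f2; rewrite E E1].
  by rewrite -E1 in c2; rewrite -[RHS]E1; apply/f2.
Qed.

Lemma saturating_cseq c d r C1 C2 :
  saturating (sem N c r) C1 -> saturating (sem N d r) C2 ->
  saturating (sem N (Seq c d) r) (fun f => C1 f /\ C2 f).
Proof. exact: saturating_seq. Qed.

Lemma saturating_ext F G C : (forall A, F A = G A) -> saturating F C ->
  saturating G C.
Proof.
by move=> FG HF A sA iA; have [*] := HF A sA iA; split; rewrite -FG.
Qed.

Lemma saturating_cnd F C D : (forall f, C f <-> D f) -> saturating F C ->
  saturating F D.
Proof.
move=> CD HF A sA iA; have [? ? ? ? f1] := HF A sA iA; split=> //.
exact: iff_trans f1 (CD _).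
Qed.

Lemma saturating_foldl (G : nat -> (V -> nat -> bool) -> (V -> nat -> bool))
    k (C : 'I_k -> (nat -> bool) -> Prop) :
  (forall i : 'I_k, saturating (G i) (C i)) ->
  saturating (fun A => foldl (fun A i => G i A) A (iota 0 k))
    (fun f => forall i : 'I_k, C i f).
Proof.
move=> H.
suff HS : forall j, j <= k ->
    saturating (fun A => foldl (fun A i => G i A) A (iota 0 j))
      (fun f => forall i : 'I_k, i < j -> C i f).
  apply: saturating_cnd (HS _ (leqnn k)) => f.
  by split=> h i; [apply: h|move=> _; apply: h].
elim=> [|j IH] jk.
  by apply: saturating_cnd saturating_id => f; split.
apply: (@saturating_ext
  (fun A => G j (foldl (fun A i => G i A) A (iota 0 j)))).
  by move=> A; rewrite -[in iota 0 j.+1]addn1 iotaD foldl_cat.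
have HS := saturating_seq (IH (ltnW jk)) (H (Ordinal jk)).
apply: saturating_cnd HS => f; split=> [[h1 h2] i|h].
  rewrite ltnS leq_eqVlt => /orP[/eqP E|/h1//].
  by rewrite (_ : i = Ordinal jk) //; apply: val_inj.
by split=> [i ij|]; apply: h; rewrite //= ltnS ltnW.
Qed.

Lemma saturating_loop x y (c : cmd V) r k
    (C : 'I_k -> (nat -> bool) -> Prop) : r y = k ->
  (forall i : 'I_k, saturating (sem N c (bind r x i)) (C i)) ->
  saturating (sem N (Loop x y c) r) (fun f => forall i : 'I_k, C i f).
Proof. by move=> /= ->; exact: saturating_foldl. Qed.

Lemma saturating_if x t c d r C D (g : bool) :
  (forall A, St A -> getA N A x (tval r t) = g) ->
  (g -> saturating (sem N c r) C) -> (~~ g -> saturating (sem N d r) D) ->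
  saturating (sem N (IfA x t c d) r) (fun f => if g then C f else D f).
Proof.
move=> H; case: g H => H Hc Hd A sA iA.
  by have [? ? ? ? ?] := Hc isT A sA iA; split; rewrite /= (H _ sA).
by have [? ? ? ? ?] := Hd isT A sA iA; split; rewrite /= (H _ sA).
Qed.

Hypothesis St_set : forall A j, St A -> St (setA N A X j b).

Definition fset (f : nat -> bool) j k := if k == j then b else f k.

Lemma setA_fset A j : j < N -> setA N A X j b X = fset (A X) j.
Proof.
move=> jN; apply: functional_extensionality => k.
by rewrite /setA /fset eqxx jN andbT.
Qed.

Lemma fset_fix f j : fset f j = f <-> f j = b.
Proof.
split=> [<-|E]; first by rewrite /fset eqxx.
by apply: functional_extensionality => k; rewrite /fset; case: eqP => // ->.
Qed.

(** [B] stands for scratch work that leaves [X] alone, such as computing a flag; the guard may then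
    be stated on [X] only. *)
Lemma saturating_guarded (F : (V -> nat -> bool) -> V -> nat -> bool)
    (B : (V -> nat -> bool) -> V -> nat -> bool)
    (g : (nat -> bool) -> bool) j :
  j < N ->
  (forall A, St A -> St (B A) /\ B A X = A X) ->
  (forall A, St A -> F A = if g (A X) then setA N (B A) X j b else B A) ->
  (forall f, I f -> g f -> I (fset f j)) ->
  saturating F (fun f => g f -> f j = b).
Proof.
move=> jN HB HF HI A sA iA; have [sB EB] := HB A sA.
case gA: (g (A X)); last first.
  by split; rewrite HF // gA ?EB.
split; rewrite HF // gA ?setA_fset // ?EB.
- exact: St_set.
- exact: HI.
- by move=> k; rewrite /fset; case: eqP.
- by move=> k kN; rewrite /fset; case: eqP => // E; rewrite E leqNgt jN in kN.
- by rewrite fset_fix; split=> // h; apply: h.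
Qed.

Lemma saturating_set t r j : tval r t = j -> j < N ->
  (forall f, I f -> I (fset f j)) ->
  saturating (sem N (SetA X t b) r) (fun f => f j = b).
Proof.
move=> tj jN HI; apply: saturating_cnd (_ : saturating _ (fun f => true -> f j = b)).
  by move=> f; split=> // h; apply: h.
apply: (saturating_guarded (B := id)) => //= [A _|f If _]; last exact: HI.
by rewrite tj.
Qed.

(* Each round that changes the array turns one more of its N cells into b, so
   N rounds reach a fixpoint. *)
Theorem saturating_iterate x y (c : cmd V) r C : r y = N ->
  (forall i, saturating (sem N c (bind r x i)) C) ->
  forall A, St A -> I (A X) -> let A' := sem N (Loop x y c) r A in
  [/\ St A', I (A' X) & C (A' X)].
Proof.
move=> rN HC A sA iA /=; rewrite rN.
pose num (f : nat -> bool) := count (fun j => f j == b) (iota 0 N).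
pose B k := foldl (fun A i => sem N c (bind r x i) A) A (iota 0 k).
have BS k : B k.+1 = sem N c (bind r x k) (B k).
  by rewrite /B -[in iota 0 k.+1]addn1 iotaD foldl_cat.
(* Either a fixpoint has been reached, and then it persists, or each of the [k] rounds has turned at
   least one more cell into [b]. *)
have : forall k, [/\ St (B k), I (B k X) & C (B k X) \/ k <= num (B k X)].
  elim=> [|k [sk ik ck]]; first by split=> //; right.
  have [s1 i1 m1 o1 f1] := HC k _ sk ik; rewrite -BS in s1 i1 m1 o1 f1.
  split=> //; case: ck => [/f1 E|ck]; first by left; rewrite E; apply/f1.
  case: (boolP (all (fun j => B k.+1 X j == B k X j) (iota 0 N))).
    move=> /allP E; left.
    have {}E : B k.+1 X = B k X.
      apply: functional_extensionality => j; case: (ltnP j N) => [jN|/o1//].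
      by apply/eqP/E; rewrite mem_iota.
    by rewrite E; apply/f1.
  rewrite -has_predC => /hasP[j jN /= /eqP jE]; right; apply: leq_ltn_trans ck _.
  rewrite /num; have jj : (B k.+1 X j == b) && (B k X j != b).
    have := m1 j; move: jE; case: (B k.+1 X j) (B k X j) b => [] [] [] // _ h;
    by have := h erefl.
  have sub (s : seq nat) :
      count (fun j => B k X j == b) s <= count (fun j => B k.+1 X j == b) s.
    by apply: sub_count => i /eqP/m1/eqP.
  elim: (iota 0 N) jN => //= i s IH; rewrite inE => /orP[/eqP<-|/IH h].
    case/andP: jj => -> /negPf ->; rewrite add0n add1n ltnS; exact: sub.
  rewrite -addnS leq_add //; case: eqP => // /m1 ->; by rewrite eqxx.
move=> /(_ N)[sN iN cN]; split=> //; case: cN => // cN.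
(* All [N] cells are equal to [b], so one further round cannot change anything. *)
have /allP allb : all (fun j => B N X j == b) (iota 0 N).
  by rewrite all_count eqn_leq count_size size_iota.
have [_ _ m1 o1 f1] := HC 0 _ sN iN; apply/f1.
apply: functional_extensionality => j; case: (ltnP j N) => [jN|/o1//].
have /eqP E : B N X j == b by apply: allb; rewrite mem_iota.
by rewrite m1 ?E.
Qed.

End Saturation.

(** * The decision program *)

(* [vW] holds the input, [vS] the weak transitions of A \ Sigma_h, [vR] the
   candidate pairs of the simulation; [vF], [vOut], [vBad] and [vOne] are flags
   (only cell 0 is used), and [vLen] stays all true, so that reading it tests
   whether an index is < N. [vs] to [vd] are loop registers; the constants
   |Q|, |Sigma| and N are on [vn1]-[vn6], [vm1]-[vm2] and [vN], in several
   copies because nested loops need distinct bound tapes. *)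
Local Notation V := 'I_23.
Definition vW : V := @Ordinal 23 0 isT.
Definition vS : V := @Ordinal 23 1 isT.
Definition vR : V := @Ordinal 23 2 isT.
Definition vF : V := @Ordinal 23 3 isT.
Definition vOut : V := @Ordinal 23 4 isT.
Definition vBad : V := @Ordinal 23 5 isT.
Definition vOne : V := @Ordinal 23 6 isT.
Definition vLen : V := @Ordinal 23 7 isT.
Definition vs : V := @Ordinal 23 8 isT.
Definition vt : V := @Ordinal 23 9 isT.
Definition vp : V := @Ordinal 23 10 isT.
Definition vq : V := @Ordinal 23 11 isT.
Definition va : V := @Ordinal 23 12 isT.
Definition vd : V := @Ordinal 23 13 isT.
Definition vn1 : V := @Ordinal 23 14 isT.
Definition vn2 : V := @Ordinal 23 15 isT.
Definition vn3 : V := @Ordinal 23 16 isT.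
Definition vn4 : V := @Ordinal 23 17 isT.
Definition vn5 : V := @Ordinal 23 18 isT.
Definition vn6 : V := @Ordinal 23 19 isT.
Definition vm1 : V := @Ordinal 23 20 isT.
Definition vm2 : V := @Ordinal 23 21 isT.
Definition vN : V := @Ordinal 23 22 isT.

Definition ns := [:: vn1; vn2; vn3; vn4; vn5; vn6].
Definition ms := [:: vm1; vm2].

Local Notation "a [+] b" := (Add a b) (at level 50, left associativity).
Local Notation "a [*] b" := (Mul a b) (at level 40, left associativity).

Definition t_header : term V := Var vn5 [+] Var vm2 [+] (One [+] One).
Definition t_high : term V := t_header [+] Var vn5 [+] Var va.
Definition t_ctrl : term V := t_header [+] Var vn5 [+] Var vm2 [+] Var va.
Definition t_index (e u v : term V) : term V :=
  (u [*] (Var vm2 [+] One) [+] e) [*] Var vn5 [+] v.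
Definition t_edge (e u v : term V) : term V :=
  t_header [+] Var vn5 [+] Var vm2 [+] Var vm2 [+] t_index e u v.
Definition t_pair (u v : term V) : term V := u [*] Var vn5 [+] v.
Definition t_action : term V := Var va [+] One.

Definition c_edges (e : term V) : cmd V :=
  Loop vs vn1 (Loop vt vn2
    (IfA vW (t_edge e (Var vs) (Var vt))
       (SetA vS (t_index e (Var vs) (Var vt)) true) Skip)).

Definition c_join (e1 e2 e : term V) : cmd V :=
  Loop vs vn1 (Loop vp vn2 (Loop vt vn3
    (IfA vS (t_index e1 (Var vs) (Var vp))
       (IfA vS (t_index e2 (Var vp) (Var vt))
          (SetA vS (t_index e (Var vs) (Var vt)) true) Skip) Skip))).

(** Labelled edges enter for uncontrollable low actions only, since the answers come from the
    restricted system without controllable edges. *)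
Definition c_closure : cmd V :=
  Seq (Loop vs vn1 (SetA vS (t_index Zero (Var vs) (Var vs)) true))
  (Seq (c_edges Zero)
  (Seq (Loop va vm1
          (IfA vW t_ctrl Skip (IfA vW t_high Skip (c_edges t_action))))
  (Seq (c_join Zero Zero Zero)
       (Loop va vm1 (Seq (c_join Zero t_action t_action)
                         (c_join t_action Zero t_action)))))).

Definition c_answer (e : term V) : cmd V :=
  Seq (SetA vF Zero false)
  (Seq (Loop vt vn4 (IfA vS (t_index e (Var vs) (Var vt))
          (IfA vR (t_pair (Var vt) (Var vq)) (SetA vF Zero true) Skip) Skip))
       (IfA vF Zero Skip (SetA vR (t_pair (Var vs) (Var vp)) false))).

(** [e] is the label of the challenging edge in the automaton, [e'] the label under which it must be
    answered; they differ for high actions, which hiding turns into epsilon. *)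
Definition c_check (e e' : term V) : cmd V :=
  Loop vp vn1 (Loop vq vn2
    (IfA vW (t_edge e (Var vp) (Var vq)) (Loop vs vn3 (c_answer e')) Skip)).

Definition c_refine : cmd V :=
  Seq (c_check Zero Zero)
    (Loop va vm1 (IfA vW t_ctrl Skip
       (IfA vW t_high (c_check t_action Zero) (c_check t_action t_action)))).

(** Lengths are compared through bounds tests on [vLen]: the input has the size of an encoding iff
    this index is in range and its successor is not. *)
Definition t_size_pred : term V :=
  Var vn5 [+] Var vm2 [+] One [+] (Var vn5 [+] Var vm2 [+] Var vm2 [+]
    Var vn5 [*] (Var vm2 [+] One) [*] Var vn6).

(** [vOne] remembers that an initial bit was seen, and a second one raises [vBad]. A missing initial
    bit needs no flag, as [vOut] then stays false. *)
Definition c_initial : cmd V :=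
  Loop vs vn1 (IfA vW (t_header [+] Var vs)
    (Seq (IfA vOne Zero (SetA vBad Zero true) (SetA vOne Zero true))
         (IfA vR (t_pair (Var vs) (Var vs)) (SetA vOut Zero true) Skip))
    Skip).

Definition c_reject : cmd V := SetA vOut Zero false.

Definition c_final : cmd V :=
  Seq (SetA vBad Zero false) (Seq (SetA vOne Zero false) (Seq c_reject
  (Seq c_initial
  (Seq (IfA vBad Zero c_reject Skip)
       (IfA vLen t_size_pred
          (IfA vLen (t_size_pred [+] One) c_reject Skip) c_reject))))).

Definition program : cmd V :=
  Seq (Loop vd vN c_closure) (Seq (Loop vd vN c_refine) c_final).

Lemma wf_program : wf [::] (scope ns ms vN) program.
Proof. by vm_compute. Qed.

(** The closure starts from nothing and the refinement from all pairs; the flags are reset before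
    use. *)
Definition fill_value (i : V) : bool := i != vS.

Section Run.
Variables (w : seq bool) (n m : nat).
Hypotheses (wn : ones w = n) (wm : ones2 w = m).
Let N := size w.
Let r0 := registers ns ms vN w.
Let A0 := input_arrays fill_value w.

Definition good (r : V -> nat) := {in scope ns ms vN, r =1 r0}.

Lemma good_bind r x i : x \notin scope ns ms vN -> good r -> good (bind r x i).
Proof.
move=> xs g y ys; rewrite /bind; case: eqP => [E|_]; last exact: g.
by rewrite -E ys in xs.
Qed.

Lemma good_n r : good r -> [/\ r vn1 = n, r vn2 = n, r vn3 = n, r vn4 = n & r vn5 = n] /\ r vn6 = n.
Proof. by move=> g; rewrite !g // -wn. Qed.

Lemma good_m r : good r -> [/\ r vm1 = m, r vm2 = m & r vN = N].
Proof. by move=> g; rewrite !g // -wm. Qed.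

Lemma t_index_val r e u v : good r ->
  tval r (t_index e u v) = (tval r u * m.+1 + tval r e) * n + tval r v.
Proof.
by move=> g /=; have [[_ _ _ _ ->] _] := good_n g; have [_ -> _] := good_m g;
  rewrite addn1.
Qed.

Lemma t_header_val r : good r -> tval r t_header = header_size n m.
Proof.
by move=> g /=; have [[_ _ _ _ ->] _] := good_n g; have [_ -> _] := good_m g.
Qed.

Lemma t_edge_val r e u v : good r ->
  tval r (t_edge e u v) = header_size n m + n + m + m +
   ((tval r u * m.+1 + tval r e) * n + tval r v).
Proof.
move=> g; rewrite -t_index_val // -(t_header_val g) /=.
by have [[_ _ _ _ ->] _] := good_n g; have [_ -> _] := good_m g.
Qed.

Lemma t_pair_val r u v : good r -> tval r (t_pair u v) = tval r u * n + tval r v.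
Proof. by move=> g /=; have [[_ _ _ _ ->] _] := good_n g. Qed.

Lemma t_high_val r : good r -> tval r t_high = header_size n m + n + r va.
Proof.
by move=> g; rewrite -(t_header_val g) /=; have [[_ _ _ _ ->] _] := good_n g.
Qed.

Lemma t_ctrl_val r : good r -> tval r t_ctrl = header_size n m + n + m + r va.
Proof.
by move=> g; rewrite -(t_header_val g) /=; have [[_ _ _ _ ->] _] := good_n g;
  have [_ -> _] := good_m g.
Qed.

Lemma input_bit A j : A vW = A0 vW -> getA N A vW j = nth false w j.
Proof.
move=> E; rewrite /getA E -[A0 vW j]/(nth false w j).
by case: ltnP => // h; rewrite nth_default.
Qed.

End Run.

(** * Correctness on encoded instances *)

Section Instance.
Variable X : instance.
Let w := encode X.
Let n := inst_states X.
Let m := inst_actions X.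
Let N := size w.
Let r0 := registers ns ms vN w.
Let A0 := input_arrays fill_value w.
Let wn : ones w = n := ones_encode X.
Let wm : ones2 w = m := ones2_encode X.
Let E := edges (inst_automaton X).
Let Sh := inst_high X.
Let Sc := inst_ctrl X.
Let U := uncontrolled (inst_automaton X) Sc.
Notation ix := (@edge_index n m).

Definition weak (s : 'I_n) (l : option 'I_m) (t : 'I_n) : Prop :=
  @weak_step _ (restrict Sh U) s l t.

Lemma edge_index_size s l t : ix s l t < N.
Proof.
apply: leq_trans (edge_index_lt s l t) _.
by rewrite /N size_encode /encoding_size /header_size; lia.
Qed.

(** * Correctness of the weak closure *)

Definition closure_static (A : V -> nat -> bool) :=
  forall y, y != vS -> A y = A0 y.

Definition closure_sound (f : nat -> bool) :=
  forall s l t, f (ix s l t) -> weak s l t.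

Lemma closure_sound_set s l t f : weak s l t -> closure_sound f ->
  closure_sound (fset true f (ix s l t)).
Proof.
move=> st If s' l' t'; rewrite /fset; case: eqP => [/edge_index_inj|_]; last exact: If.
by case=> -> -> ->.
Qed.

Lemma closure_static_set A j : closure_static A ->
  closure_static (setA N A vS j true).
Proof.
move=> sA y ys; rewrite -sA //; apply: functional_extensionality => k.
by rewrite /setA (negPf ys).
Qed.

Notation closing := (saturating N vS true closure_static closure_sound).

(** Quantified over all [r'] that agree on [va], because the term is evaluated under inner loops
    that bind further registers. *)
Definition denotes (r : V -> nat) e (l : option 'I_m) :=
  forall r', r' va = r va -> tval r' e = label_index l.

Lemma input_edge A r e u v s l t : good w r -> A vW = A0 vW ->
  tval r e = label_index l -> tval r u = nat_of_ord s -> tval r v = nat_of_ord t ->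
  getA N A vW (tval r (t_edge e u v)) = ((s, l, t) \in E).
Proof.
move=> g AW Ee Eu Ev; rewrite (input_bit _ AW) (t_edge_val wn wm) // Ee Eu Ev.
exact: encode_edges.
Qed.

Lemma closing_edges r e l : good w r -> denotes r e l ->
  (forall s t, (s, l, t) \in E -> weak s l t) ->
  closing (sem N (c_edges e) r) (fun f => forall s t : 'I_n,
    if (s, l, t) \in E then f (ix s l t) = true else True).
Proof.
move=> g He Hw.
apply: saturating_loop => [|s]; first by have [[]] := good_n wn g.
have g1 : good w (bind r vs s) by apply: good_bind.
apply: saturating_loop => [|t]; first by have [[]] := good_n wn g1.
set r' := bind _ _ _.
have g' : good w r' by apply: good_bind.
have e' : tval r' e = label_index l by apply: He.
apply: (@saturating_if _ _ _ _ _ _ _ _ _ _ _ _ _ ((s, l, t) \in E))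
  => [A sA|st|_]; last exact: saturating_id.
  exact: (input_edge g' (sA vW isT) e').
apply: saturating_set.
- exact: closure_static_set.
- by rewrite (t_index_val wn wm) // e'.
- exact: edge_index_size.
- by move=> f; apply: closure_sound_set; apply: Hw.
Qed.

Lemma closing_join r e1 e2 e l1 l2 l : good w r ->
  denotes r e1 l1 -> denotes r e2 l2 -> denotes r e l ->
  (forall s p t, weak s l1 p -> weak p l2 t -> weak s l t) ->
  closing (sem N (c_join e1 e2 e) r) (fun f => forall s p t : 'I_n,
    f (ix s l1 p) && f (ix p l2 t) ->
    f (ix s l t) = true).
Proof.
move=> g He1 He2 He Hw.
apply: saturating_loop => [|s]; first by have [[]] := good_n wn g.
have g1 : good w (bind r vs s) by apply: good_bind.
apply: saturating_loop => [|p]; first by have [[]] := good_n wn g1.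
have g2 : good w (bind (bind r vs s) vp p) by apply: good_bind.
apply: saturating_loop => [|t]; first by have [[]] := good_n wn g2.
set r' := bind _ vt _.
have g' : good w r' by apply: good_bind.
apply: (@saturating_guarded _ _ _ _ _ _ _ _ id
  (fun f => f (ix s l1 p) && f (ix p l2 t))).
- exact: closure_static_set.
- exact: edge_index_size.
- by [].
- move=> A sA; rewrite /sem -/sem !(t_index_val wn wm) // (He1 r') // (He2 r') // (He r') //.
  have getE i k j : getA N A vS (ix i k j) = A vS (ix i k j).
    by rewrite /getA edge_index_size.
  rewrite -[X in getA _ _ _ X]/(ix s l1 p) getE.
  rewrite -[X in getA _ _ _ X]/(ix p l2 t) getE.
  by case: (A vS _) => //=; case: (A vS _).
- move=> f If /andP[/If f1 /If f2]; apply: closure_sound_set => //.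
  exact: Hw f1 f2.
Qed.

Lemma weak_trans_eps_l s p l t : weak s None p -> weak p l t -> weak s l t.
Proof.
case: l => [a|] sp /=; last exact: rt_trans.
move=> [p1 [p2 [pp1 p12 p2t]]]; exists p1, p2; split=> //.
exact: rt_trans sp pp1.
Qed.

Lemma weak_trans_eps_r s p l t : weak s l p -> weak p None t -> weak s l t.
Proof.
case: l => [a|] /=; last exact: rt_trans.
move=> [p1 [p2 [pp1 p12 p2t]]] pt; exists p1, p2; split=> //.
exact: rt_trans p2t pt.
Qed.

Definition closure_cnd (f : nat -> bool) :=
  [/\ forall s : 'I_n, f (ix s None s) = true,
      forall s t, if (s, None, t) \in E then f (ix s None t) = true else True,
      forall a : 'I_m, if a \in Sc then True else if a \in Sh then True else
        forall s t, if (s, Some a, t) \in E then f (ix s (Some a) t) = true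
          else True
    & forall l (s p t : 'I_n), 
       (f (ix s None p) && f (ix p l t) ->
        f (ix s l t) = true) /\
       (f (ix s l p) && f (ix p None t) ->
        f (ix s l t) = true)].

Lemma denotes_zero r : denotes r Zero None. Proof. by []. Qed.

Lemma denotes_action r (a : 'I_m) : r va = a -> denotes r t_action (Some a).
Proof. by move=> ra r' E' /=; rewrite E' ra addn1. Qed.

Lemma input_ctrl A r (a : 'I_m) : good w r -> A vW = A0 vW -> r va = a ->
  getA N A vW (tval r t_ctrl) = (a \in Sc).
Proof.
move=> g AW ra; rewrite (input_bit _ AW) (t_ctrl_val wn wm) // ra.
exact: encode_ctrl.
Qed.

Lemma input_high A r (a : 'I_m) : good w r -> A vW = A0 vW -> r va = a ->
  getA N A vW (tval r t_high) = (a \in Sh).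
Proof.
move=> g AW ra; rewrite (input_bit _ AW) (t_high_val wn wm) // ra.
exact: encode_high.
Qed.

Lemma closing_closure r : good w r -> closing (sem N c_closure r) closure_cnd.
Proof.
move=> g.
have gm : r vm1 = m by have [] := good_m wm g.
(* The condition is left open, assembled from the pieces of the program, and compared with
   [closure_cnd] at the end. *)
eapply saturating_cnd; last first.
  eapply saturating_cseq.
    eapply (@saturating_loop _ _ _ _ _ _ _ _ _ _ n) => [|s]; first by have [[]] := good_n wn g.
    eapply (@saturating_set _ _ _ _ _ _ closure_static_set _ _ (ix s None s)).
    - by rewrite (t_index_val wn wm) //; apply: good_bind.
    - exact: edge_index_size.
    - by move=> f; apply: closure_sound_set; apply: rt_refl.
  eapply saturating_cseq.
    eapply (closing_edges g (@denotes_zero r)) => s t st.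
    by apply: weak_step_single; rewrite /= st.
  eapply saturating_cseq.
    eapply (saturating_loop gm) => a.
    have ga : good w (bind r va a) by apply: good_bind.
    eapply (@saturating_if _ _ _ _ _ _ _ _ _ _ _ _ _ (a \in Sc)) => [A sA|_|nc].
    - exact: input_ctrl ga (sA vW isT) _.
    - exact: saturating_id.
    eapply (@saturating_if _ _ _ _ _ _ _ _ _ _ _ _ _ (a \in Sh)) => [A sA|_|nh].
    - exact: input_high ga (sA vW isT) _.
    - exact: saturating_id.
    eapply (closing_edges ga (l := Some a)) => [|s t st]; first exact: denotes_action.
    by apply: weak_step_single; split=> //=; rewrite [_ \in _]st.
  eapply saturating_cseq.
    eapply (closing_join g (@denotes_zero r) (@denotes_zero r) (@denotes_zero r)).
    by move=> s p t; apply: weak_trans_eps_l.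
  eapply (saturating_loop gm) => a.
  have ga : good w (bind r va a) by apply: good_bind.
  have da : denotes (bind r va a) t_action (Some a) by apply: denotes_action.
  eapply saturating_cseq.
    eapply (closing_join ga (@denotes_zero _) da da); move=> s p t;
      by apply: weak_trans_eps_l.
  eapply (closing_join ga da (@denotes_zero _) da); move=> s p t;
      by apply: weak_trans_eps_r.
move=> f; split.
  move=> [h1 [h2 [h3 [h4 h5]]]]; split=> // l s p t.
  case: l => [a|]; first by have [h6 h7] := h5 a; split; [exact: h6|exact: h7].
  by split; exact: h4.
move=> [h1 h2 h3 h4]; do 3!split=> //; split=> [s p t|a].
  by have [] := h4 None s p t.
by split=> s p t; have [] := h4 (Some a) s p t.
Qed.

Let A1 := sem N (Loop vd vN c_closure) r0 A0.

(** Soundness is the invariant of the saturation. Completeness comes from the fixpoint condition, a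
    weak step being composed of silent steps, one edge and silent steps. *)
Lemma closure_correct :
  closure_static A1 /\
  forall s l t, A1 vS (ix s l t) <-> weak s l t.
Proof.
have [] := @saturating_iterate _ N vS true closure_static closure_sound
  vd vN c_closure r0 closure_cnd (erefl _ : r0 vN = N) _ A0.
- by move=> i; apply: closing_closure; apply: good_bind.
- by [].
- by [].
rewrite -/A1 => st snd [c1 c2 c3 c4]; split=> // s l t; split; first exact: snd.
have eps u v : weak u None v -> A1 vS (ix u None v).
  elim=> {u v} [u v /andP[uv _]|u|u p v _ h1 _ h2] //.
    by have := c2 u v; rewrite [_ \in _]uv.
  by have [-> //] := c4 None u p v; rewrite h1.
case: l => [a|]; last exact: eps.
move=> [s1 [s2 [/eps e1 [ah /andP[st12 ac]] /eps e2]]].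
have e12 : A1 vS (ix s1 (Some a) s2).
  by have := c3 a; rewrite (negPf ac) (negPf ah) => /(_ s1 s2); rewrite [_ \in _]st12.
have e3 : A1 vS (ix s1 (Some a) t).
  by have [_ ->] := c4 (Some a) s1 s2 t; rewrite ?e12.
by have [-> //] := c4 (Some a) s s1 t; rewrite e1.
Qed.

Lemma closure_unchanged y : y != vS -> A1 y = A0 y.
Proof. by case: closure_correct => h _; apply: h. Qed.

(** * Correctness of the refinement *)

Definition pair_index (s p : 'I_n) : nat := s * n + p.

Lemma pair_index_size s p : pair_index s p < N.
Proof.
have H : pair_index s p < n * n.
  by rewrite /pair_index; have := ltn_ord s; have := ltn_ord p; nia.
apply: leq_trans H _; rewrite /N size_encode -/n -/m /encoding_size -mulnA mulSn.
by rewrite mulnDr; lia.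
Qed.

Lemma pair_index_inj s p s' p' : pair_index s p = pair_index s' p' ->
  s = s' /\ p = p'.
Proof.
rewrite /pair_index => H; have := ltn_ord p; have := ltn_ord p' => h' h.
have E1 : s = s' :> nat.
  have /= := congr1 (fun k => k %/ n) H.
  by rewrite !divnMDl ?(leq_ltn_trans _ h) // !divn_small // !addn0.
split; apply: val_inj => //=; by move: H; rewrite E1 => /addnI.
Qed.

Section Refine.
(** An arbitrary simulation, which every refinement step keeps inside the array; the array that
    remains thus contains all simulations. *)
Variable Rsim : 'I_n -> 'I_n -> Prop.
Hypothesis Rsim_step : forall s p l q, Rsim s p ->
  @lts_step _ (hide Sh U) p l q -> exists2 t, weak s l t & Rsim t q.

Definition refine_static (A : V -> nat -> bool) :=
  forall y, y != vR -> y != vF -> A y = A1 y.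

Definition refine_complete (f : nat -> bool) :=
  forall s p, Rsim s p -> f (pair_index s p).

Lemma refine_static_set A j : refine_static A ->
  refine_static (setA N A vR j false).
Proof.
move=> sA y yR yF; rewrite -sA //; apply: functional_extensionality => k.
by rewrite /setA (negPf yR).
Qed.

Notation refining := (saturating N vR false refine_static refine_complete).

Definition answered l (s q : 'I_n) (f : nat -> bool) : bool :=
  [exists t : 'I_n, A1 vS (ix s l t) && f (pair_index t q)].

(** A pair of [Rsim] is never deleted: its answer is a weak step, hence recorded in [vS], and leads
    to a pair of [Rsim], which is still in the array. *)
Lemma refining_answer r e l (s p q : 'I_n) : good w r -> denotes r e l ->
  r vs = s -> r vp = p -> r vq = q ->
  (Rsim s p -> exists2 t, weak s l t & Rsim t q) ->
  refining (sem N (c_answer e) r)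
    (fun f => ~~ answered l s q f -> f (pair_index s p) = false).
Proof.
move=> g He Es Ep Eq Hsim.
have N0 : 0 < N by apply: leq_ltn_trans (pair_index_size s p).
apply: (@saturating_guarded _ _ _ _ _ _ _ _
  (fun A => setA N A vF 0 (answered l s q (A vR)))).
- exact: refine_static_set.
- exact: pair_index_size.
- move=> A sA; split; last first.
    by apply: functional_extensionality => k.
  move=> y yR yF; rewrite -sA //; apply: functional_extensionality => k.
  by rewrite /setA (negPf yF).
- move=> A sA; have -> : sem N (c_answer e) r A =
    let B := foldl (fun B t =>
       if getA N B vS (tval (bind r vt t) (t_index e (Var vs) (Var vt))) then
         if getA N B vR (tval (bind r vt t) (t_pair (Var vt) (Var vq)))
         then setA N B vF 0 true else B
       else B) (setA N A vF 0 false) (iota 0 (r vn4)) in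
    if getA N B vF 0 then B
    else setA N B vR (tval r (t_pair (Var vs) (Var vp))) false by [].
  cbv zeta.
  have [[_ _ _ -> _] _] := good_n wn g.
  rewrite (@foldl_flag _ _ _ _ _ (fun t =>
    A1 vS ((s * m.+1 + label_index l) * n + t) && A vR (t * n + q))); last first.
    move=> t c tn; set r' := bind _ _ _.
    have g' : good w r' by apply: good_bind.
    rewrite (t_index_val wn wm) // (t_pair_val wn) // (He r') //.
    rewrite -[tval r' (Var vs)]/(r vs) -[tval r' (Var vt)]/t -[tval r' (Var vq)]/(r vq).
    rewrite Es Eq.
    have -> : getA N (setA N A vF 0 c) vS ((s * m.+1 + label_index l) * n + t) =
       A1 vS ((s * m.+1 + label_index l) * n + t).
      by rewrite /getA [_ < N](edge_index_size s l (Ordinal tn)) -(sA vS isT isT).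
    have -> : getA N (setA N A vF 0 c) vR (t * n + q) = A vR (t * n + q).
      by rewrite /getA [_ < N](pair_index_size (Ordinal tn) q).
    case: (A1 vS _); case: (A vR _); rewrite ?orbF ?orbT //=.
    by rewrite setA_setA.
  rewrite orFb; set b' := has _ _.
  have -> : b' = answered l s q (A vR).
    apply/hasP/existsP => [[t]|[t h]].
      by rewrite mem_iota => /andP[_ tn] h; exists (Ordinal tn).
    by exists (nat_of_ord t); rewrite // mem_iota /=.
  rewrite (t_pair_val wn) // -[tval r (Var vs)]/(r vs) -[tval r (Var vp)]/(r vp) Es Ep.
  have -> : getA N (setA N A vF 0 (answered l s q (A vR))) vF 0 = answered l s q (A vR).
    by rewrite /getA /setA N0.
  by case: (answered _ _ _ _).
- move=> f If; rewrite negb_exists => /forallP na s' p'; rewrite /fset.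
  case: eqP => [/pair_index_inj[-> ->] /Hsim[t wt Rt]|_]; last exact: If.
  have := na t; rewrite If // andbT => /negP[].
  by case: closure_correct => _ h; apply/h.
Qed.

Lemma refining_check r e e' l l' : good w r -> denotes r e l -> denotes r e' l' ->
  (forall p q, (p, l, q) \in E -> @lts_step _ (hide Sh U) p l' q) ->
  refining (sem N (c_check e e') r) (fun f => forall p q : 'I_n,
    if (p, l, q) \in E then
      forall s : 'I_n, ~~ answered l' s q f -> f (pair_index s p) = false
    else True).
Proof.
move=> g He He' Hst.
apply: saturating_loop => [|p]; first by have [[]] := good_n wn g.
have g1 : good w (bind r vp p) by apply: good_bind.
apply: saturating_loop => [|q]; first by have [[]] := good_n wn g1.
set r' := bind _ _ _.
have g' : good w r' by apply: good_bind.
apply: (@saturating_if _ _ _ _ _ _ _ _ _ _ _ _ _ ((p, l, q) \in E))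
  => [A sA|st|_]; last exact: saturating_id.
  apply: (input_edge g' _ (He _ _)) => //.
  by rewrite sA // closure_unchanged.
apply: saturating_loop => [|s]; first by have [[]] := good_n wn g'.
have gs : good w (bind r' vs s) by apply: good_bind.
apply: (refining_answer gs) => // Rsp.
by apply: Rsim_step Rsp (Hst _ _ st).
Qed.

Definition check_cnd l l' (f : nat -> bool) := forall p q : 'I_n,
  if (p, l, q) \in E then
    forall s : 'I_n, ~~ answered l' s q f -> f (pair_index s p) = false
  else True.

Definition refine_cnd (f : nat -> bool) :=
  check_cnd None None f /\
  forall a : 'I_m, if a \in Sc then True else
    if a \in Sh then check_cnd (Some a) None f else check_cnd (Some a) (Some a) f.

Lemma refining_refine r : good w r -> refining (sem N c_refine r) refine_cnd.
Proof.
move=> g.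
have gm : r vm1 = m by have [] := good_m wm g.
apply: saturating_cseq.
  apply: (refining_check g (@denotes_zero r) (@denotes_zero r)) => p q st.
  by left; rewrite /= [_ \in _]st.
apply: (saturating_loop gm) => a.
have ga : good w (bind r va a) by apply: good_bind.
have da : denotes (bind r va a) t_action (Some a) by apply: denotes_action.
have AW A : refine_static A -> A vW = A0 vW.
  by move=> sA; rewrite sA // closure_unchanged.
apply: (@saturating_if _ _ _ _ _ _ _ _ _ _ _ _ _ (a \in Sc)) => [A sA|_|nc].
- exact: input_ctrl ga (AW A sA) _.
- exact: saturating_id.
apply: (@saturating_if _ _ _ _ _ _ _ _ _ _ _ _ _ (a \in Sh)) => [A sA|ah|nh].
- exact: input_high ga (AW A sA) _.
- apply: (refining_check ga da (@denotes_zero _)) => p q st.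
  by right; exists a => //=; rewrite [_ \in _]st.
- apply: (refining_check ga da da) => p q st.
  by split=> //=; rewrite [_ \in _]st.
Qed.

End Refine.

Let A2 := sem N (Loop vd vN c_refine) r0 A1.

Lemma refine_correct :
  A2 vR (pair_index (initial (inst_automaton X)) (initial (inst_automaton X))) <->
  weakly_simulates (restrict Sh U) (hide Sh U).
Proof.
have iter Rsim (H : forall s p l q, Rsim s p ->
    @lts_step _ (hide Sh U) p l q -> exists2 t, weak s l t & Rsim t q) :
    refine_complete Rsim (A2 vR) /\ refine_cnd (A2 vR).
  have [] := @saturating_iterate _ N vR false refine_static (refine_complete Rsim)
    vd vN c_refine r0 refine_cnd (erefl _ : r0 vN = N) _ A1.
  - by move=> i; apply: refining_refine H _ _; apply: good_bind.
  - by [].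
  - by move=> s p _; rewrite closure_unchanged.
  by [].
split; last first.
  move=> [Rsim [R0 HR]]; have [h _] := iter Rsim (fun s p l q h st =>
    HR s p l q h (weak_step_single st)).
  exact: h.
(* The empty relation is a simulation, so the fixpoint condition is available without any
   assumption; it says that the final array is itself a simulation. *)
have [//|_ [c0 ca]] := iter (fun _ _ => False).
move=> R0; exists (fun s p => A2 vR (pair_index s p)); split=> //.
have ans l s q : ~~ (~~ answered l s q (A2 vR)) -> 
  exists2 t, weak s l t & A2 vR (pair_index t q).
  rewrite negbK => /existsP[t /andP[h1 h2]]; exists t => //.
  by case: closure_correct => _ h; apply/h.
apply: weak_step_simulation => s p l q Rsp st.
have chk k : check_cnd k l (A2 vR) -> (p, k, q) \in E ->
  exists2 t, weak s l t & A2 vR (pair_index t q).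
  move=> c pq; apply: ans => //; apply/negP => na.
  by have := c p q; rewrite pq => /(_ s na); rewrite Rsp.
case: l st chk {ans} => [a [ah /andP[st ac]]|[/andP[st _]|[a ah /andP[st ac]]]] chk.
- by have := ca a; rewrite (negPf ac) (negPf ah) => /chk; apply.
- exact: chk c0 st.
- by have := ca a; rewrite (negPf ac) ah => /chk; apply.
Qed.

End Instance.

(** * Validation of the input *)

Section Final.
Variables (w : seq bool).
Let N := size w.
Let n := ones w.
Let m := ones2 w.
Let r0 := registers ns ms vN w.
Let A0 := input_arrays fill_value w.
Variable A : V -> nat -> bool.
Hypothesis AW : A vW = A0 vW.
Hypothesis AL : A vLen = A0 vLen.

Definition initial_bit q := nth false w (header_size n m + q).
Definition diagonal_bit q := getA N A vR (q * n + q).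

Lemma setA_same (B : V -> nat -> bool) x b : 0 < N -> setA N B x 0 b x 0 = b.
Proof. by rewrite /setA eqxx => ->. Qed.

Lemma setA_other (B : V -> nat -> bool) x y j b : y != x ->
  setA N B x j b y = B y.
Proof.
by move=> yx; apply: functional_extensionality => k; rewrite /setA (negPf yx).
Qed.

Lemma initial_loop B : 0 < N ->
  (forall y, y \notin [:: vOut; vBad; vOne] -> B y = A y) ->
  B vOut 0 = false -> B vBad 0 = false -> B vOne 0 = false ->
  let B' := sem N c_initial r0 B in
  [/\ forall y, y \notin [:: vOut; vBad; vOne] -> B' y = A y,
      B' vOut 0 = has (fun q => initial_bit q && diagonal_bit q) (iota 0 n)
    & B' vBad 0 = (1 < count initial_bit (iota 0 n))].
Proof.
move=> N0 BA B1 B2 B3.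
have -> : sem N c_initial r0 B = foldl (fun B q =>
  if getA N B vW (tval (bind r0 vs q) (Add t_header (Var vs))) then
    let B1 := if getA N B vOne 0 then setA N B vBad 0 true
              else setA N B vOne 0 true in
    if getA N B1 vR (tval (bind r0 vs q) (t_pair (Var vs) (Var vs)))
    then setA N B1 vOut 0 true else B1
  else B) B (iota 0 n) by [].
set G := (fun B q => _).
(* The value of [vOne] joins the invariant because it decides when [vBad] is raised. *)
suff H k : let B' := foldl G B (iota 0 k) in
  [/\ forall y, y \notin [:: vOut; vBad; vOne] -> B' y = A y,
      B' vOut 0 = has (fun q => initial_bit q && diagonal_bit q) (iota 0 k),
      B' vBad 0 = (1 < count initial_bit (iota 0 k))
    & B' vOne 0 = (0 < count initial_bit (iota 0 k))].
  by have [] := H n.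
elim: k => [//|k]; cbv zeta => -[h h1 h2 h3].
rewrite -[in iota 0 k.+1]addn1 iotaD foldl_cat has_cat count_cat /=.
move: (foldl G B (iota 0 k)) h h1 h2 h3 => D h h1 h2 h3.
have g : good w (bind r0 vs k) by apply: good_bind.
rewrite /G -[tval _ (Add _ _)]/(tval (bind r0 vs k) t_header + k).
rewrite (t_header_val (erefl n) (erefl m) g).
rewrite (input_bit _ (_ : D vW = A0 vW)) -/(initial_bit k); last by rewrite h.
rewrite (t_pair_val (erefl n)) // -[tval _ (Var vs)]/k.
case: (initial_bit k); rewrite /= ?orbF ?addn0 //.
set D1 := (if getA N D vOne 0 then _ else _).
have D1E y : y \notin [:: vOut; vBad; vOne] -> D1 y = A y.
  rewrite /D1 => yy; move: (yy); rewrite !inE !negb_or => /and3P[_ y2 y3].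
  by case: ifP => _; rewrite setA_other // ?h.
have -> : getA N D1 vR (k * n + k) = diagonal_bit k.
  by rewrite /diagonal_bit /getA D1E.
have D1o : D1 vOut 0 = has (fun q => initial_bit q && diagonal_bit q) (iota 0 k).
  by rewrite /D1; case: ifP => _; rewrite setA_other.
have D1b : D1 vBad 0 = (1 < count initial_bit (iota 0 k) + 1).
  rewrite /D1 {1}/getA N0 h3; case: ifP => /= c0.
    by rewrite setA_same // addn1 ltnS c0.
  by rewrite setA_other // h2; lia.
have D1i : D1 vOne 0 = (0 < count initial_bit (iota 0 k) + 1).
  rewrite /D1 {1}/getA N0 h3 addn1 ltnS leq0n; case: ifP => /= c0.
    by rewrite setA_other // h3 c0.
  by rewrite setA_same.
case: (diagonal_bit k); rewrite ?orbF ?orbT; split=> //.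
- move=> y yy; move: (yy); rewrite !inE !negb_or => /and3P[y1 _ _].
  by rewrite setA_other // D1E.
- by rewrite setA_same.
Qed.

Lemma t_size_pred_val : tval r0 t_size_pred = (encoding_size n m).-1.
Proof.
rewrite -[LHS]/(n + m + 1 + (n + m + m + n * (m + 1) * n)).
by rewrite /encoding_size /header_size addn1; lia.
Qed.

Lemma length_bit (B : V -> nat -> bool) j : B vLen = A0 vLen ->
  getA N B vLen j = (j < N).
Proof. by move=> E; rewrite /getA E andbT. Qed.

Lemma final_correct :
  getA N (sem N c_final r0 A) vOut 0 =
  [&& N == encoding_size n m, count initial_bit (iota 0 n) <= 1
    & has (fun q => initial_bit q && diagonal_bit q) (iota 0 n)].
Proof.
have sz : 1 < encoding_size n m by rewrite /encoding_size /header_size; lia.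
(* On the empty word cell 0 is out of bounds and no flag can be stored, but reading false is right,
   as every encoding has length at least 2. *)
case: (posnP N) => [N0|N0].
  by rewrite /getA N0 /=; case: eqP => // h; rewrite -h in sz.
have -> : sem N c_final r0 A =
  let B := sem N c_initial r0
    (setA N (setA N (setA N A vBad 0 false) vOne 0 false) vOut 0 false) in
  let B1 := if getA N B vBad 0 then setA N B vOut 0 false else B in
  if getA N B1 vLen (tval r0 t_size_pred) then
    if getA N B1 vLen (tval r0 t_size_pred + 1)
    then setA N B1 vOut 0 false else B1
  else setA N B1 vOut 0 false by [].
set D := setA N (setA N _ _ _ _) vOut 0 false.
have [] := @initial_loop D N0.
- move=> y; rewrite !inE !negb_or => /and3P[y1 y2 y3].
  by rewrite /D !setA_other.
- by rewrite /D setA_same.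
- by rewrite /D setA_other // setA_other // setA_same.
- by rewrite /D setA_other // setA_same.
cbv zeta; move: (sem N c_initial r0 D) => B BA Bo Bb.
set B1 := (if getA N B vBad 0 then _ else _).
have B1L : B1 vLen = A0 vLen.
  by rewrite /B1; case: ifP => _; rewrite ?setA_other // BA.
rewrite !length_bit // t_size_pred_val.
have -> : (N == encoding_size n m) =
    ((encoding_size n m).-1 < N) && ~~ ((encoding_size n m).-1 + 1 < N) by lia.
case: ltnP => _ /=; last by rewrite /getA setA_same // andbF.
case: ltnP => _ /=; first by rewrite /getA setA_same // andbF.
rewrite /getA N0 /= /B1 /getA N0 Bb /=; case: ltnP => _ /=.
  by rewrite setA_same.
by rewrite Bo.
Qed.

End Final.

Lemma program_correct w :
  getA (size w) (sem (size w) program (registers ns ms vN w)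
    (input_arrays fill_value w)) vOut 0 <-> CSNNI_control_problem w.
Proof.
set N := size w; set r0 := registers _ _ _ _; set A0 := input_arrays _ _.
pose A1 := sem N (Loop vd vN c_closure) r0 A0.
pose A2 := sem N (Loop vd vN c_refine) r0 A1.
have A2E y : y \notin [:: vS; vR; vF] -> A2 y = A0 y.
  rewrite !inE !negb_or => /and3P[y1 y2 y3].
  rewrite /A2 sem_unwritten; last first.
    rewrite [writes _]/= !inE !negb_or.
    by rewrite ?y1 ?y2 ?y3.
  by rewrite /A1 sem_unwritten // [writes _]/= !inE !negb_or y1.
have -> : sem N program r0 A0 = sem N c_final r0 A2 by [].
rewrite final_correct; [|exact: A2E|exact: A2E].
(* [A2] is defined for every word; only on an encoding does it represent the greatest simulation. *)
have main (X : instance) : w = encode X ->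
    diagonal_bit w A2 (initial (inst_automaton X)) <->
    CSNNI_controllable (inst_automaton X) (inst_ctrl X) (inst_high X).
  move=> wX; rewrite controllable_uncontrolled -refine_correct.
  rewrite /diagonal_bit /getA -/N /A2 /A1 /N /r0 /A0 {}wX ones_encode.
  by rewrite -[X in X < _]/(pair_index _ _) pair_index_size.
split.
  case/and3P=> /eqP sz c1 /hasP[q]; rewrite mem_iota add0n => /andP[_ qn].
  case/andP=> wq Rq.
  have uni q1 q2 : q1 < ones w -> q2 < ones w -> initial_bit w q1 ->
      initial_bit w q2 -> q1 = q2.
    move=> h1 h2 b1 b2; apply: contraTeq c1 => ne; rewrite -ltnNge -size_filter.
    apply: (@uniq_leq_size _ [:: q1; q2]); first by rewrite /= inE ne.
    move=> x; rewrite !inE mem_filter mem_iota add0n leq0n /=.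
    by case/orP=> /eqP ->; rewrite ?b1 ?b2.
  have [|X wX] := encode_surj sz uni; first by exists q.
  exists X => //; apply/(main X wX).
  have nE : ones w = inst_states X by rewrite wX ones_encode.
  have mE : ones2 w = inst_actions X by rewrite wX ones2_encode.
  rewrite nE in qn; suff <- : Ordinal qn = initial (inst_automaton X) by [].
  apply/eqP; rewrite -encode_initial -wX.
  by move: wq; rewrite /initial_bit nE mE.
case=> X wX /(main X wX) RX.
have nE : ones w = inst_states X by rewrite wX ones_encode.
have mE : ones2 w = inst_actions X by rewrite wX ones2_encode.
have bitE q : q < inst_states X ->
    initial_bit w q = (q == initial (inst_automaton X)).
  move=> qn; rewrite /initial_bit nE mE wX.
  exact: (encode_initial (Ordinal qn)).
rewrite {1}wX size_encode nE mE eqxx /=; apply/andP; split.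
  rewrite (@eq_in_count _ _ (pred1 (nat_of_ord (initial (inst_automaton X))))).
    by rewrite count_uniq_mem ?iota_uniq // leq_b1.
  by move=> q; rewrite mem_iota add0n => /bitE.
apply/hasP; exists (nat_of_ord (initial (inst_automaton X))).
  by rewrite mem_iota /=.
by rewrite bitE ?eqxx ?ltn_ord.
Qed.

Theorem theorem9 : in_PTIME CSNNI_control_problem.
Proof.
exact: (@decider_in_PTIME _ fill_value ns ms vN vOut program _
  isT isT isT isT isT wf_program program_correct).
Qed.
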